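(* For every $p=1,2,\ldots$ we have the equations $$\operatorname{Li}_{2p}(x)+\operatorname{Li}_{2p}(x^{-1})=\frac{(-1)^{p+1}(2\pi)^{2p}}{(2p)!}\,B_{2p}\!\left(\frac{\log(x)}{2\pi i}\right)$$ and $$\operatorname{Li}_{2p+1}(x)-\operatorname{Li}_{2p+1}(x^{-1})=\frac{(-1)^{p+1}(2\pi)^{2p+1}\,i}{(2p+1)!}\,B_{2p+1}\!\left(\frac{\log(x)}{2\pi i}\right).$$
   Context: $\operatorname{Li}_n(z)=\sum_{k=1}^\infty \frac{z^k}{k^n}$ is the polylogarithm, continuous on the closed unit disk $|z|\le 1$ and analytic in its interior; outside the disk it is understood as extended beyond the unit disk. $B_n(x)$, $n=0,1,2,\ldots$, are the Bernoulli polynomials defined by $\frac{te^{xt}}{e^t-1}=\sum_{n=0}^\infty B_n(x)\frac{t^n}{n!}$. The logarithm is the principal branch, $\log(z)=\ln|z|+i\operatorname{Arg}(z)$ with $-\pi<\operatorname{Arg}(z)\le\pi$, so that $\log(re^{i\pi})=\ln(r)+i\pi$ for $r>0$.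
   Formalization: x is restricted to nonzero x with Im x ≥ 0, since with the principal log both equations fail in the open lower half-plane (e.g. p=1, x=-i); for positive x≠1, Li on the cut (1,∞) is the limit from above at x, or from below at 1/x. *)

(* Defs.v *)
From Stdlib Require Import Arith Factorial Reals.
From Coquelicot Require Import Coquelicot.

Open Scope R_scope.
Open Scope C_scope.

Definition Cexp (z : C) : C := (exp (Re z) * cos (Im z), exp (Re z) * sin (Im z))%R.

(* Takes its values in (-PI, PI] for z <> 0; the value at 0 is meaningless. *)
Definition Carg (z : C) : R :=
  if Rle_dec 0 (Im z) then acos (Re z / Cmod z) else (- acos (Re z / Cmod z))%R.

Definition Clog (z : C) : C := (ln (Cmod z), Carg z).

(* B n is the n-th Bernoulli polynomial as a function on C:
   t e^(xt) / (e^t - 1) = sum_n B_n(x) t^n / n!  for all small t <> 0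
   (the left-hand side has a removable singularity at t = 0). *)
Definition is_bernoulli (B : nat -> C -> C) : Prop :=
  forall x : C, locally' (RtoC 0) (fun t : C =>
    is_pseries (fun n : nat => B n x / RtoC (INR (fact n))) t
      (t * Cexp (x * t) / (Cexp t - 1))).

Definition analytic_at (f : C -> C) (z0 : C) : Prop :=
  exists a : nat -> C, locally z0 (fun z : C => is_pseries a (z - z0) (f z)).

(* f is Li_n (n >= 2): the sum of the series on the closed unit disk, extended
   analytically to the plane slit along [1, +oo). By the identity theorem this
   determines f everywhere except on the open cut (1, +oo), where Li_n has two
   distinct boundary values and f is left unconstrained. *)
Definition is_polylog (n : nat) (f : C -> C) : Prop :=
  (forall z : C, Cmod z <= 1 ->
     is_series (fun k : nat => z ^ S k / RtoC (INR (S k) ^ n)) (f z)) /\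
  (forall z : C, ~ (1 <= Re z /\ Im z = 0%R) -> analytic_at f z).

Definition on_cut (z : C) : Prop := 1 < Re z /\ Im z = 0%R.

Definition limit_from_above (f : C -> C) (z : C) : Prop :=
  filterlim f (within (fun w : C => 0 < Im w) (locally z)) (locally (f z)).

Definition limit_from_below (f : C -> C) (z : C) : Prop :=
  filterlim f (within (fun w : C => Im w < 0) (locally z)) (locally (f z)).

(* Main.v *)
Require Import Defs.
From Stdlib Require Import Arith Factorial Reals Lra Lia Psatz IndefiniteDescription.
From Coquelicot Require Import Coquelicot.
Open Scope R_scope.
Open Scope C_scope.

(** Put x = e^w with 0 < Im w < 2 pi and consider, for every n >= 0,

      P_n(w) = Li_n(e^w) + (-1)^n Li_n(e^(-w)) + (2 pi i)^n beta_n(w / (2 pi i)),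

    where beta_n = B_n / n!. Both parts of the theorem say that P_n = 0 for n >= 2, and they are
    obtained by integrating upwards from n = 0.

    On the plane slit along [1, +oo) one has z Li_(n+1)'(z) = Li_n(z), with Li_0(z) = z / (1 - z)
    ([polylog_ext_derive]), and beta_(n+1)' = beta_n ([scaled_bernoulli_derive]). Hence
    P_(n+1)' = P_n, while P_0 = 0 is an identity between rational functions of e^w. It remains to see
    that the constants of integration vanish. Two points suffice. At w = i pi, that is x = 1/x = -1,
    the odd P_n vanish because beta_n(1/2) = 0. As w tends to 0, that is x tends to 1, the odd P_n with
    n >= 3 tend to 0 because beta_n(0) = 0 and Li_n is continuous on the closed disk. If P_(2m+1) = 0,
    then P_(2m+2) is a constant c and P_(2m+3) is linear in w with slope c; being zero at both points,
    it vanishes identically and c = 0 ([inversion_defect_vanishes_pair]).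

    Every x with Im x >= 0 that is not a positive real number is covered by the strip, with
    w = log x. For x > 0 one lets w tend to ln x from above: x is then approached from the upper
    half-plane and 1/x from the lower one, which is how the values on the cut are prescribed
    ([inversion_defect_boundary]).

    The relation z Li_(n+1)' = Li_n holds for the power series in the unit disk, and it propagates to
    the slit plane by the identity theorem along the segments issued from 0
    ([analytic_zero_on_ray]), which rests on term-by-term differentiation of complex power series
    ([is_pseries_Cderive]). The properties of the Bernoulli polynomials are read off the generating
    function: coefficients of a germ are unique ([has_germ_unique]) and those of a product are given by
    the Cauchy product formula ([has_germ_mult]). *)

(** * Complex derivatives *)

Notation C_line := (AbsRing_NormedModule C_AbsRing).

(** The codomain is [C] normed over itself by [Cmod], the structure for which the general product
    and chain rules are available; the other canonical structure on [C] carries the product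
    topology of the plane. [locally_Cmod] translates between the two. *)
Definition is_cderive (f : C -> C) (z l : C) : Prop := @is_derive C_AbsRing C_line f z l.

(* Equations between elements of a [NormedModule] that is convertible to [C] are restated in [C]
   for the benefit of [ring] and [field]. *)
Ltac Cring := match goal with |- @eq _ ?a ?b => change (@eq C a b) end; ring.

Ltac Cfield := match goal with |- @eq _ ?a ?b => change (@eq C a b) end; field.

Lemma RtoC_neq_0 (x : R) : x <> 0%R -> RtoC x <> 0.
Proof. intros H E. apply H, RtoC_inj, E. Qed.

Lemma Rabs_Re_le (z : C) : Rabs (Re z) <= Cmod z.
Proof. eapply Rle_trans; [apply Rmax_l | apply Rmax_Cmod]. Qed.

Lemma Rabs_Im_le (z : C) : Rabs (Im z) <= Cmod z.
Proof. eapply Rle_trans; [apply Rmax_r | apply Rmax_Cmod]. Qed.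

Lemma locally_Cmod (z : C) (P : C -> Prop) :
  locally z P <-> exists d : R, 0 < d /\ forall y : C, Cmod (y - z) < d -> P y.
Proof.
  split.
  - intro H. apply locally_C in H. destruct H as [d Hd].
    exists (pos d). split; [apply cond_pos|]. intros y Hy. apply Hd. exact Hy.
  - intros [d [Hd H]]. apply locally_C. exists (mkposreal d Hd). intros y Hy. apply H. exact Hy.
Qed.

Lemma locally'_Cmod (z : C) (P : C -> Prop) :
  locally' z P <->
  exists d : R, 0 < d /\ forall y : C, Cmod (y - z) < d -> y <> z -> P y.
Proof. apply locally_Cmod. Qed.

Lemma is_cderive_eps (f : C -> C) (z l : C) :
  is_cderive f z l <->
  forall eps : R, 0 < eps -> exists d : R, 0 < d /\
    forall y : C, Cmod (y - z) < d ->
      Cmod (f y - f z - (y - z) * l) <= eps * Cmod (y - z).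
Proof.
  split.
  - intros [_ H] eps Heps.
    destruct (H z (fun P HP => HP) (mkposreal eps Heps)) as [d Hd].
    exists (pos d). split; [apply cond_pos|]. intros y Hy. apply (Hd y). exact Hy.
  - intro H. split; [apply is_linear_scal_l|].
    intros z' Hz'. assert (E : z = z') by exact (@is_filter_lim_locally_unique C_AbsRing C_line z z' Hz'). subst z'.
    intros [eps Heps]. destruct (H eps Heps) as [d [Hd H']].
    exists (mkposreal d Hd). intros y Hy. apply H'. exact Hy.
Qed.

(** The only way in which derivatives are computed from scratch below: for power series and for the
    exponential a quadratic remainder is as easy to get as a small one. *)
Lemma is_cderive_quadratic (f : C -> C) (z l : C) (K d : R) :
  0 < d ->
  (forall h : C, Cmod h < d -> Cmod (f (z + h) - f z - h * l) <= K * (Cmod h * Cmod h)) ->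
  is_cderive f z l.
Proof.
  intros Hd H. apply is_cderive_eps. intros eps Heps.
  assert (HK : 0 < Rabs K + 1) by (generalize (Rabs_pos K); lra).
  (* K may be negative or zero, hence the constant |K| + 1. *)
  exists (Rmin d (eps / (Rabs K + 1))). split.
  { apply Rmin_glb_lt; trivial. apply Rdiv_lt_0_compat; lra. }
  intros y Hy.
  assert (H1 := H (y - z) (Rlt_le_trans _ _ _ Hy (Rmin_l _ _))).
  replace (z + (y - z)) with y in H1 by ring.
  eapply Rle_trans; [exact H1|].
  rewrite <- Rmult_assoc. apply Rmult_le_compat_r; [apply Cmod_ge_0|].
  assert (Hy' := Rlt_le_trans _ _ _ Hy (Rmin_r _ _)).
  assert (H2 := Cmod_ge_0 (y - z)).
  apply Rle_trans with ((Rabs K + 1) * Cmod (y - z))%R.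
  - apply Rmult_le_compat_r; trivial. generalize (Rle_abs K); lra.
  - apply Rle_trans with ((Rabs K + 1) * (eps / (Rabs K + 1)))%R.
    + apply Rmult_le_compat_l; lra.
    + right. field. lra.
Qed.

Lemma is_cderive_continuous (f : C -> C) (z l : C) :
  is_cderive f z l -> filterlim f (locally z) (locally (f z)).
Proof.
  intro H. intros P HP. apply locally_Cmod in HP. destruct HP as [e [He HP]].
  apply locally_Cmod.
  destruct (proj1 (is_cderive_eps f z l) H 1%R Rlt_0_1) as [d [Hd H']].
  assert (Hl := Cmod_ge_0 l).
  exists (Rmin d (e / (2 + Cmod l))). split.
  { apply Rmin_glb_lt; trivial. apply Rdiv_lt_0_compat; lra. }
  intros y Hy. apply HP.
  assert (H1 := H' y (Rlt_le_trans _ _ _ Hy (Rmin_l _ _))).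
  assert (H2 := Rlt_le_trans _ _ _ Hy (Rmin_r _ _)).
  replace (f y - f z) with (f y - f z - (y - z) * l + (y - z) * l) by ring.
  eapply Rle_lt_trans; [apply Cmod_triangle|]. rewrite Cmod_mult.
  assert (H3 := Cmod_ge_0 (y - z)).
  apply Rle_lt_trans with ((1 + Cmod l) * Cmod (y - z))%R; [lra|].
  apply Rle_lt_trans with ((1 + Cmod l) * (e / (2 + Cmod l)))%R.
  { apply Rmult_le_compat_l; lra. }
  apply Rlt_le_trans with ((2 + Cmod l) * (e / (2 + Cmod l)))%R.
  - apply Rmult_lt_compat_r; [apply Rdiv_lt_0_compat; lra | lra].
  - right. field. lra.
Qed.

Lemma is_cderive_ext (f g : C -> C) (z l : C) :
  (forall w, f w = g w) -> is_cderive f z l -> is_cderive g z l.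
Proof. apply (@is_derive_ext C_AbsRing C_line). Qed.

Lemma is_cderive_plus (f g : C -> C) (z l m : C) :
  is_cderive f z l -> is_cderive g z m -> is_cderive (fun w => f w + g w) z (l + m).
Proof. apply (@is_derive_plus C_AbsRing C_line). Qed.

Lemma is_cderive_mult (f g : C -> C) (z l m : C) :
  is_cderive f z l -> is_cderive g z m ->
  is_cderive (fun w => f w * g w) z (l * g z + f z * m).
Proof. intros Hf Hg. exact (is_derive_mult f g z l m Hf Hg Cmult_comm). Qed.

Lemma is_cderive_comp (f g : C -> C) (z l m : C) :
  is_cderive f (g z) l -> is_cderive g z m -> is_cderive (fun w => f (g w)) z (m * l).
Proof. apply (@is_derive_comp C_AbsRing C_line). Qed.

Lemma is_cderive_const (c z : C) : is_cderive (fun _ => c) z 0.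
Proof. apply (@is_derive_const C_AbsRing C_line). Qed.

Lemma is_cderive_id (z : C) : is_cderive (fun w => w) z 1.
Proof. apply (@is_derive_id C_AbsRing). Qed.

Lemma is_cderive_linear (c z : C) : is_cderive (fun w => c * w) z c.
Proof.
  generalize (is_cderive_mult _ _ z _ _ (is_cderive_const c z) (is_cderive_id z)).
  now replace (0 * z + c * 1) with c by ring.
Qed.

Lemma is_cderive_C_derive (f : C -> C) (z l : C) : is_cderive f z l -> C_derive f z = l.
Proof.
  intros [_ H]. apply is_C_derive_unique. split; [apply is_linear_scal_l | exact H].
Qed.

Lemma is_cderive_shift (f : C -> C) (z0 u l : C) :
  is_cderive (fun v => f (z0 + v)) u l -> is_cderive f (z0 + u) l.
Proof.
  intro H. apply is_cderive_eps. intros eps Heps.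
  destruct (proj1 (is_cderive_eps _ _ _) H eps Heps) as [d [Hd H']].
  exists d. split; trivial. intros y Hy. specialize (H' (y - z0)).
  replace (y - z0 - u) with (y - (z0 + u)) in H' by ring.
  replace (z0 + (y - z0)) with y in H' by ring. now apply H'.
Qed.

(** Real and imaginary parts are treated at once: [pr] is either of them, and the real mean value
    theorem applies to [pr] of [f] along the segment. *)
Lemma zero_cderive_part (pr : C -> R) (f : C -> C) (a b : C) :
  (forall u v : C, pr (u - v) = (pr u - pr v)%R) ->
  (forall u : C, Rabs (pr u) <= Cmod u) ->
  (forall t : R, 0 <= t <= 1 -> is_cderive f (a + t * (b - a)) 0) ->
  pr (f b) = pr (f a).
Proof.
  intros Hsub Hle Hf.
  set (g := fun t : R => pr (f (a + t * (b - a)))).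
  assert (Hg : forall t : R, 0 <= t <= 1 -> is_derive g t 0%R).
  { intros t Ht. split; [apply is_linear_scal_l|].
    intros t' Ht'. assert (E : t = t') by exact (@is_filter_lim_locally_unique R_AbsRing R_NormedModule t t' Ht').
    subst t'. intros [eps Heps].
    assert (Hba := Cmod_ge_0 (b - a)).
    destruct (proj1 (is_cderive_eps _ _ _) (Hf t Ht) (eps / (Cmod (b - a) + 1))%R) as [d [Hd H]].
    { apply Rdiv_lt_0_compat; lra. }
    assert (Hd' : 0 < d / (Cmod (b - a) + 1)) by (apply Rdiv_lt_0_compat; lra).
    exists (mkposreal _ Hd').
    refine (fun (s : R) (Hs : Rabs (s - t) < d / (Cmod (b - a) + 1)) => _).
    change (Rabs (g s - g t - (s - t) * 0) <= eps * Rabs (s - t)).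
    replace (g s - g t - (s - t) * 0)%R
      with (pr (f (a + s * (b - a)) - f (a + t * (b - a)))) by (rewrite Hsub; unfold g; ring).
    specialize (H (a + RtoC s * (b - a))).
    replace (a + s * (b - a) - (a + t * (b - a))) with (RtoC (s - t) * (b - a)) in H
      by (rewrite RtoC_minus; ring).
    rewrite Cmod_mult, Cmod_R in H. assert (Hst := Rabs_pos (s - t)).
    assert (H1 : Rabs (s - t) * (Cmod (b - a) + 1) < d).
    { apply (Rmult_lt_compat_r (Cmod (b - a) + 1)) in Hs; [|lra].
      replace (d / (Cmod (b - a) + 1) * (Cmod (b - a) + 1))%R with d in Hs by (field; lra). exact Hs. }
    eapply Rle_trans; [apply Hle|].
    replace (f (a + s * (b - a)) - f (a + t * (b - a)) - RtoC (s - t) * (b - a) * 0)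
      with (f (a + s * (b - a)) - f (a + t * (b - a))) in H by ring.
    eapply Rle_trans; [apply H; nra|].
    replace (eps / (Cmod (b - a) + 1) * (Rabs (s - t) * Cmod (b - a)))%R
      with (eps * Rabs (s - t) * (Cmod (b - a) / (Cmod (b - a) + 1)))%R by (field; lra).
    rewrite <- (Rmult_1_r (eps * Rabs (s - t))) at 2.
    apply Rmult_le_compat_l; [nra|].
    apply Rmult_le_reg_r with (Cmod (b - a) + 1)%R; [lra|].
    replace (Cmod (b - a) / (Cmod (b - a) + 1) * (Cmod (b - a) + 1))%R with (Cmod (b - a)) by (field; lra).
    lra. }
  destruct (MVT_gen g 0 1 (fun _ => 0%R)) as [c [_ Hc]].
  - intros t Ht. rewrite Rmin_left, Rmax_right in Ht by lra. apply Hg. lra.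
  - intros t Ht. rewrite Rmin_left, Rmax_right in Ht by lra.
    apply continuity_pt_filterlim. apply (ex_derive_continuous g t). exists 0%R. apply Hg, Ht.
  - unfold g in Hc.
    replace (a + 1%R * (b - a)) with b in Hc by ring.
    replace (a + 0%R * (b - a)) with a in Hc by ring. lra.
Qed.

Lemma zero_cderive_segment (f : C -> C) (a b : C) :
  (forall t : R, 0 <= t <= 1 -> is_cderive f (a + t * (b - a)) 0) -> f b = f a.
Proof.
  intro H. apply injective_projections.
  - apply (zero_cderive_part Re); trivial using Rabs_Re_le.
  - apply (zero_cderive_part Im); trivial using Rabs_Im_le.
Qed.

(** * Complex power series *)

Lemma pow_n_Cpow (z : C) (n : nat) : @pow_n C_Ring z n = z ^ n.
Proof.
  induction n as [|n IH]; [reflexivity|]. rewrite Cpow_S, <- IH. reflexivity.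
Qed.

Lemma is_pseries_C (a : nat -> C) (z l : C) :
  is_pseries a z l <-> is_series (fun n => a n * z ^ n) l.
Proof.
  assert (E : forall n, scal (pow_n z n) (a n) = a n * z ^ n).
  { intro n. rewrite (pow_n_Cpow z n). apply Cmult_comm. }
  split; apply is_series_ext; intro n; [apply E | symmetry; apply E].
Qed.

Lemma is_pseries_C_unique (a : nat -> C) (z l m : C) :
  is_pseries a z l -> is_pseries a z m -> l = m.
Proof. apply (@filterlim_locally_unique nat C_AbsRing C_NormedModule eventually _). Qed.

Lemma is_series_Cmod_le (a : nat -> C) (b : nat -> R) (l : C) :
  is_series a l -> (forall n, Cmod (a n) <= b n) -> ex_series b -> Cmod l <= Series b.
Proof.
  intros Ha Hab Hb. apply Series_correct in Hb.
  assert (H : filterlim (fun n => norm (sum_n a n)) eventually (locally (norm l))).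
  { eapply filterlim_comp; [exact Ha|apply filterlim_norm]. }
  refine (filterlim_le (F := eventually) _ _ (Finite (Cmod l)) (Finite (Series b)) _ H Hb).
  exists 0%nat. intros n _. eapply Rle_trans; [apply (norm_sum_n_m a)|].
  apply sum_n_m_le. exact Hab.
Qed.

Lemma ex_series_terms_bounded (a : nat -> C) (l : C) :
  is_series a l -> exists M : R, forall n, Cmod (a n) <= M.
Proof.
  intro H.
  destruct (filterlim_bounded (sum_n a)) as [M HM]; [exists l; exact H|].
  exists (M + M)%R. intro n. assert (H0 := Cmod_ge_0 (sum_n a 0)).
  destruct n as [|n].
  - rewrite <- (sum_O a). generalize (HM 0%nat). change (norm (sum_n a 0)) with (Cmod (sum_n a 0)). lra.
  - replace (a (S n)) with (sum_n a (S n) - sum_n a n)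
      by (rewrite sum_Sn; change plus with Cplus; ring).
    eapply Rle_trans; [apply Cmod_triangle|]. rewrite Cmod_opp.
    apply Rplus_le_compat; apply HM.
Qed.

(** Convergence at a real point of modulus larger than the radius of [Cmod (a n)] would bound the
    terms there and so contradict the definition of that radius. This brings in absolute convergence
    and the real theory of the radius of convergence. *)
Lemma CV_radius_Cmod (a : nat -> C) (r : R) :
  (forall z : C, Cmod z < r -> exists l : C, is_pseries a z l) ->
  Rbar_le r (CV_radius (fun n => Cmod (a n))).
Proof.
  intro H.
  destruct (Rbar_le_lt_dec r (CV_radius (fun n => Cmod (a n)))) as [|Hlt]; [trivial|exfalso].
  assert (H0 := CV_radius_ge_0 (fun n => Cmod (a n))).
  destruct (CV_radius_bounded (fun n => Cmod (a n))) as [Hub _].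
  destruct (CV_radius (fun n => Cmod (a n))) as [s| |]; try (simpl in *; contradiction).
  simpl in H0, Hlt.
  set (t := ((r + s) / 2)%R).
  destruct (H (RtoC t)) as [l Hl].
  { rewrite Cmod_R, Rabs_pos_eq; unfold t; lra. }
  apply is_pseries_C in Hl. apply ex_series_terms_bounded in Hl. destruct Hl as [M HM].
  assert (H1 : Rbar_le t s).
  { apply Hub. exists M. intro n. eapply Rle_trans; [right|exact (HM n)].
    rewrite Cmod_mult, Cmod_pow, Cmod_R, Rabs_mult, <- RPow_abs.
    rewrite (Rabs_pos_eq (Cmod _)); [reflexivity|apply Cmod_ge_0]. }
  simpl in H1. unfold t in H1. lra.
Qed.

Lemma is_series_lincomb (a b c : nat -> C) (la lb lc k : C) :
  is_series a la -> is_series b lb -> is_series c lc ->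
  is_series (fun n => a n - b n - k * c n) (la - lb - k * lc).
Proof.
  intros Ha Hb Hc.
  exact (is_series_plus _ _ _ _ (is_series_plus _ _ _ _ Ha (is_series_opp _ _ Hb))
          (is_series_opp _ _ (is_series_scal k _ _ Hc))).
Qed.

Lemma is_pseries_lincomb (k : C) (a b : nat -> C) (t l m : C) :
  is_pseries a t l -> is_pseries b t m -> is_pseries (fun n => a n - k * b n) t (l - k * m).
Proof.
  intros Hf Hg. apply is_pseries_C in Hf. apply is_pseries_C in Hg. apply is_pseries_C.
  assert (H := is_series_plus _ _ _ _ Hf (is_series_opp _ _ (is_series_scal k _ _ Hg))).
  revert H. apply is_series_ext. intro n.
  change (a n * t ^ n + - (k * (b n * t ^ n)) = (a n - k * b n) * t ^ n). ring.
Qed.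

Lemma is_pseries_zero_coef (a : nat -> C) (t l : C) :
  (forall n, a n = 0) -> is_pseries a t l -> l = 0.
Proof.
  intros Ha Hl. apply is_pseries_C in Hl.
  apply (@filterlim_locally_unique nat C_AbsRing C_NormedModule eventually _ (fun _ => RtoC 0));
    [|apply filterlim_const].
  apply (filterlim_ext (sum_n (fun n => a n * t ^ n))); [|exact Hl].
  intro n. rewrite (sum_n_ext _ (fun _ => zero)); [|intro k; rewrite Ha; apply Cmult_0_l].
  apply (sum_n_m_const_zero (G := C_AbelianMonoid)).
Qed.

Definition one_coef (n : nat) : C := match n with O => 1 | _ => 0 end.

Lemma is_pseries_one (t : C) : is_pseries one_coef t (RtoC 1).
Proof.
  apply is_pseries_C. apply (is_series_decr_1 (K := C_AbsRing) (V := C_NormedModule)).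
  intros P HP. exists 0%nat. intros n _.
  match goal with |- P ?s => replace s with (RtoC 0) end.
  2:{ symmetry. rewrite (sum_n_ext _ (fun _ => zero)); [|intro k; apply Cmult_0_l].
      apply (sum_n_m_const_zero (G := C_AbelianMonoid)). }
  replace (RtoC 0) with (plus (RtoC 1) (opp (1 * t ^ 0))); [exact (locally_singleton _ _ HP)|].
  change (1 + - (1 * 1) = 0). ring.
Qed.

(** Induction from D_(n+1) = (z + h) D_n + n h^2 z^(n-1), where D_n is the remainder of the n-th
    power. The factor r^2 on the left avoids the exponent n - 2. *)
Lemma Cpow_diff_quadratic (z h : C) (r : R) (n : nat) :
  Cmod z <= r -> Cmod (z + h) <= r ->
  Cmod ((z + h) ^ n - z ^ n - h * (INR n * z ^ pred n)) * (r * r)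
    <= (Cmod h * Cmod h) * (INR n * INR n * r ^ n).
Proof.
  intros Hz Hzh. assert (Hh := Cmod_ge_0 h). assert (H0 := Cmod_ge_0 z).
  induction n as [|n IH].
  { replace (_ - _ - _) with (RtoC 0) by (simpl; ring).
    rewrite Cmod_0. simpl. lra. }
  assert (E : (z + h) ^ S n - z ^ S n - h * (INR (S n) * z ^ pred (S n))
    = (z + h) * ((z + h) ^ n - z ^ n - h * (INR n * z ^ pred n)) + h * h * (INR n * z ^ pred n)).
  { destruct n as [|n]; [simpl; ring|].
    rewrite (S_INR (S n)), RtoC_plus. simpl pred. rewrite !Cpow_S. ring. }
  rewrite E. clear E.
  set (D := (z + h) ^ n - z ^ n - h * (INR n * z ^ pred n)) in *.
  apply Rle_trans with ((r * Cmod D + Cmod h * Cmod h * (INR n * Cmod z ^ pred n)) * (r * r))%R.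
  - apply Rmult_le_compat_r; [nra|].
    eapply Rle_trans; [apply Cmod_triangle|]. rewrite !Cmod_mult, Cmod_pow, Cmod_R.
    rewrite (Rabs_pos_eq (INR n)) by apply pos_INR.
    apply Rplus_le_compat_r, Rmult_le_compat_r; [apply Cmod_ge_0 | exact Hzh].
  - assert (Hp : (INR n * Cmod z ^ pred n * (r * r) <= INR n * (r * r ^ n))%R).
    { destruct n as [|n]; [simpl; lra|]. simpl pred.
      rewrite Rmult_assoc. apply Rmult_le_compat_l; [apply pos_INR|].
      replace (r * r ^ S n)%R with (r ^ n * (r * r))%R by (simpl; ring).
      apply Rmult_le_compat_r; [nra|]. apply pow_incr. lra. }
    assert (Hr : 0 <= r ^ n) by (apply pow_le; lra).
    rewrite S_INR. simpl (r ^ S n)%R. assert (Hn := pos_INR n).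
    assert (H1 := Rmult_le_compat_l r _ _ ltac:(lra) IH).
    assert (H2 : 0 <= Cmod h * Cmod h) by nra.
    assert (H3 := Rmult_le_compat_l _ _ _ H2 Hp).
    assert (H4 : 0 <= (Cmod h * Cmod h) * (r * r ^ n)) by (apply Rmult_le_pos; nra).
    nra.
Qed.

Definition PS_Cderive (a : nat -> C) (n : nat) : C := INR (S n) * a (S n).

(** Term-by-term differentiation: the remainders of the powers add up to a constant times h^2,
    because n^2 |a_n| rho^n is summable inside the disk of convergence. *)
Lemma is_pseries_Cderive (a : nat -> C) (f : C -> C) (r : R) :
  (forall z, Cmod z < r -> is_pseries a z (f z)) ->
  forall z, Cmod z < r ->
  exists l : C, is_pseries (PS_Cderive a) z l /\ is_cderive f z l.
Proof.
  intros Hf z Hz.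
  set (al := fun n => Cmod (a n)).
  assert (Hcv : Rbar_le r (CV_radius al)).
  { apply CV_radius_Cmod. intros y Hy. exists (f y). apply Hf, Hy. }
  assert (Hz0 := Cmod_ge_0 z).
  (* A radius with |z| < rho < r leaves room for both z and z + h. *)
  set (rho := ((Cmod z + r) / 2)%R).
  assert (Hrho : Rbar_lt (Rabs rho) (CV_radius al)).
  { apply Rbar_lt_le_trans with (2 := Hcv). simpl. rewrite Rabs_pos_eq; unfold rho; lra. }
  assert (Hrho0 : 0 < rho) by (unfold rho; lra).
  (* Applying x d/dx twice to the series of absolute values gives the coefficients n^2 |a_n|
     without changing the radius, so the remainder bounds are summable at rho. *)
  set (q := PS_incr_1 (PS_derive (PS_incr_1 (PS_derive al)))).
  assert (Hq : forall n, q n = (INR n * INR n * al n)%R).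
  { intros [|[|n]]; unfold q, PS_incr_1, PS_derive; unfold zero; cbn -[INR]; cbn; ring. }
  assert (Hexq : ex_series (fun n => INR n * INR n * al n * rho ^ n)%R).
  { assert (Hc : Rbar_lt (Rabs rho) (CV_radius q)).
    { unfold q. rewrite CV_radius_incr_1, CV_radius_derive, CV_radius_incr_1, CV_radius_derive.
      exact Hrho. }
    apply CV_radius_inside in Hc. destruct Hc as [l Hl]. exists l.
    apply is_pseries_R in Hl. revert Hl. apply is_series_ext. intro n. now rewrite Hq. }
  assert (Hexl : exists l : C, is_series (fun n => PS_Cderive a n * z ^ n) l).
  { apply (@ex_series_le C_AbsRing C_CompleteNormedModule) with
      (b := fun n => Rabs (PS_derive al n * Cmod z ^ n)).
    - intro n. change (norm (PS_Cderive a n * z ^ n : C_CompleteNormedModule))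
        with (Cmod (PS_Cderive a n * z ^ n)).
      unfold PS_Cderive, PS_derive, al.
      rewrite !Cmod_mult, Cmod_pow, Cmod_R, !Rabs_mult, <- RPow_abs, !(Rabs_pos_eq (Cmod _)) by apply Cmod_ge_0. lra.
    - apply CV_disk_inside. rewrite CV_radius_derive.
      apply Rbar_lt_le_trans with (2 := Hcv). simpl. rewrite Rabs_pos_eq; lra. }
  destruct Hexl as [l Hl]. exists l. split; [now apply is_pseries_C|].
  (* Dividing by rho^2 undoes the normalisation of the bound on each power. *)
  set (K := (Series (fun n => INR n * INR n * al n * rho ^ n) / (rho * rho))%R).
  apply is_cderive_quadratic with (K := K) (d := (rho - Cmod z)%R); [unfold rho; lra|].
  intros h Hh.
  assert (Hzh : Cmod (z + h) <= rho).
  { eapply Rle_trans; [apply Cmod_triangle|]. lra. }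
  assert (Hzr : Cmod z <= rho) by (unfold rho; lra).
  assert (S1 := Hf (z + h) ltac:(unfold rho in *; lra)). apply is_pseries_C in S1.
  assert (S2 := Hf z Hz). apply is_pseries_C in S2.
  assert (S3 : is_series (fun n => INR n * z ^ pred n * a n) l).
  { apply is_series_decr_1.
    replace (plus l _) with l.
    - revert Hl. apply is_series_ext. intro n. unfold PS_Cderive. simpl pred. Cring.
    - change (l = l + - (0 * z ^ 0 * a 0%nat)). Cring. }
  assert (S4 := is_series_lincomb _ _ _ _ _ _ h S1 S2 S3).
  assert (Hrr : 0 < rho * rho) by nra.
  assert (S5 := is_series_Cmod_le _
    (fun n => (Cmod h * Cmod h / (rho * rho)) * (INR n * INR n * al n * rho ^ n))%R _ S4).
  rewrite Series_scal_l in S5.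
  replace (K * (Cmod h * Cmod h))%R with
    (Cmod h * Cmod h / (rho * rho) * Series (fun n => INR n * INR n * al n * rho ^ n))%R
    by (unfold K; field; lra).
  apply S5.
  - intro n.
    replace (_ - _ - _) with (a n * ((z + h) ^ n - z ^ n - h * (INR n * z ^ pred n))) by ring.
    rewrite Cmod_mult. fold (al n).
    assert (B := Cpow_diff_quadratic z h rho n Hzr Hzh).
    assert (B' := Rmult_le_compat_l (al n / (rho * rho)) _ _
      ltac:(apply Rdiv_le_0_compat; [apply Cmod_ge_0|lra]) B).
    eapply Rle_trans; [|eapply Rle_trans; [exact B'|]]; right; field; lra.
  - apply (ex_series_scal_l _ _ Hexq).
Qed.

(** * Germs of power series at the origin *)

(** The origin is excluded because the generating function of the Bernoulli polynomials is only given
    there as a quotient 0/0. A germ with these coefficients is nevertheless determined by them. *)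
Definition has_germ (a : nat -> C) (f : C -> C) : Prop :=
  locally' (RtoC 0) (fun t => is_pseries a t (f t)).

(** Filling in the value [a 0] at the origin gives a differentiable function. *)
Lemma has_germ_limit (a : nat -> C) (f : C -> C) :
  has_germ a f -> filterlim f (locally' (RtoC 0)) (locally (a 0%nat)).
Proof.
  intro H. apply locally'_Cmod in H. destruct H as [r [Hr H]].
  set (g := fun t : C => if Ceq_dec t 0 then a 0%nat else f t).
  assert (Hg : forall z, Cmod z < r -> is_pseries a z (g z)).
  { intros z Hz. unfold g. destruct (Ceq_dec z 0) as [->|Hz0].
    - exact (is_pseries_0 a).
    - apply H; trivial. now replace (z - 0) with z by ring. }
  destruct (is_pseries_Cderive a g r Hg 0) as [l [_ Hl]].
  { rewrite Cmod_0. exact Hr. }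
  apply is_cderive_continuous in Hl.
  assert (E : g 0 = a 0%nat) by (unfold g; destruct (Ceq_dec 0 0); congruence).
  rewrite E in Hl. intros P HP. specialize (Hl P HP).
  unfold locally', within. unfold filtermap in *.
  revert Hl. apply filter_imp. intros t Ht Ht0. unfold g in Ht.
  destruct (Ceq_dec t 0); [contradiction | exact Ht].
Qed.

Lemma ray_locally' (z : C) :
  z <> 0 -> filterlim (fun s : R => s * z) (at_right 0) (locally' (RtoC 0)).
Proof.
  intros Hz P HP. apply locally'_Cmod in HP. destruct HP as [d [Hd HP]].
  assert (Hz' := proj1 (Cmod_gt_0 z) Hz).
  assert (Hd' : 0 < d / Cmod z) by (apply Rdiv_lt_0_compat; lra).
  exists (mkposreal _ Hd'). intros s Hs Hs0.
  change (Rabs (s - 0) < d / Cmod z) in Hs. rewrite Rminus_0_r in Hs.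
  apply HP.
  - replace (s * z - 0) with (s * z) by ring. rewrite Cmod_mult, Cmod_R.
    apply (Rmult_lt_compat_r (Cmod z)) in Hs; trivial.
    replace (d / Cmod z * Cmod z)%R with d in Hs by (field; lra). exact Hs.
  - apply Cmult_neq_0; trivial. intro E. apply RtoC_inj in E. lra.
Qed.

(** Removing the constant term and dividing by the variable shifts the coefficients; this is the
    induction step for every statement about all coefficients of a germ. *)
Lemma has_germ_peel (a : nat -> C) (f : C -> C) :
  has_germ a f -> has_germ (fun n => a (S n)) (fun t => (f t - a 0%nat) / t).
Proof.
  unfold has_germ, locally', within. apply filter_imp. intros t H Ht. specialize (H Ht).
  apply (is_pseries_decr_1 _ _ (/ t)) in H; [|now apply Cinv_l].
  replace ((f t - a 0%nat) / t) with (/ t * (f t + - a 0%nat)) by (unfold Cdiv; ring).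
  exact H.
Qed.

(** Isolated zeros, in the form needed for analytic continuation along a ray: the constant term is the
    limit 0, and peeling it off preserves the vanishing. *)
Lemma has_germ_zero_on_ray (z : C) (a : nat -> C) (f : C -> C) :
  z <> 0 -> has_germ a f -> at_right 0 (fun s : R => f (s * z) = 0) ->
  forall n, a n = 0.
Proof.
  intros Hz. 
  assert (H0 : forall a f, has_germ a f -> at_right 0 (fun s : R => f (s * z) = 0) -> a 0%nat = 0).
  { clear a f. intros a f Ha Hf.
    apply (@filterlim_locally_unique R C_AbsRing C_NormedModule (at_right 0) (Proper_StrongProper _ (at_right_proper_filter 0)) (fun s : R => f (s * z))).
    - eapply filterlim_comp; [apply ray_locally', Hz | exact (has_germ_limit a f Ha)].
    - apply (filterlim_ext_loc (fun _ => RtoC 0)); [|apply filterlim_const].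
      revert Hf. apply filter_imp. intros s Hs. now rewrite Hs. }
  intros Ha Hf n. revert a f Ha Hf. induction n as [|n IH]; intros a f Ha Hf.
  - now apply (H0 a f).
  - apply (IH (fun n => a (S n)) (fun t => (f t - a 0%nat) / t)).
    + now apply has_germ_peel.
    + rewrite (H0 a f Ha Hf). revert Hf. apply filter_imp. intros s ->. unfold Cdiv. ring.
Qed.

Lemma has_germ_lincomb (k : C) (a b : nat -> C) (f g : C -> C) :
  has_germ a f -> has_germ b g ->
  has_germ (fun n => a n - k * b n) (fun t => f t - k * g t).
Proof.
  intros Ha Hb. unfold has_germ in *.
  generalize (filter_and (F := locally' (RtoC 0)) _ _ Ha Hb). apply filter_imp.
  intros t [Hf Hg]. now apply is_pseries_lincomb.
Qed.

Lemma has_germ_ext (a : nat -> C) (f g : C -> C) :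
  locally' (RtoC 0) (fun t => f t = g t) -> has_germ a f -> has_germ a g.
Proof.
  intros E H. unfold has_germ in *. generalize (filter_and (F := locally' (RtoC 0)) _ _ E H). apply filter_imp. intros t [<- Ht]. exact Ht.
Qed.

Lemma has_germ_unique (a b : nat -> C) (f : C -> C) :
  has_germ a f -> has_germ b f -> forall n, a n = b n.
Proof.
  intros Ha Hb n.
  assert (H : a n - 1 * b n = 0).
  { apply (has_germ_zero_on_ray 1 (fun n => a n - 1 * b n) (fun t => f t - 1 * f t)).
    - exact C1_nz.
    - now apply has_germ_lincomb.
    - apply filter_forall. intro s. ring. }
  replace (b n) with (b n + (a n - 1 * b n)) by (rewrite H; ring). ring.
Qed.

Lemma has_germ_opp (a : nat -> C) (f : C -> C) :
  has_germ a f -> has_germ (fun n => (- (1)) ^ n * a n) (fun t => f (- t)).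
Proof.
  intro H. apply locally'_Cmod in H. destruct H as [r [Hr H]].
  apply locally'_Cmod. exists r. split; trivial. intros t Ht Ht0.
  assert (H' : is_pseries a (- t) (f (- t))).
  { apply H.
    - replace (- t - 0) with (- (t - 0)) by ring. now rewrite Cmod_opp.
    - intro E. apply Ht0. replace t with (- - t) by ring. rewrite E. ring. }
  apply is_pseries_C in H'. apply is_pseries_C. revert H'. apply is_series_ext. intro n.
  replace (- t) with (- (1) * t) by ring. rewrite Cpow_mult_l. Cring.
Qed.

Lemma filterlim_Cmult {T : Type} (F : (T -> Prop) -> Prop) {FF : Filter F} (f g : T -> C) (x y : C) :
  filterlim f F (locally x) -> filterlim g F (locally y) ->
  filterlim (fun t => f t * g t) F (locally (x * y)).
Proof.
  assert (E : forall (h : T -> C) (z : C),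
    filterlim h F (locally z) <-> filterlim h F (@locally (AbsRing_UniformSpace C_AbsRing) z)).
  { intros h z. split; intros H P HP; apply H; now apply locally_C. }
  intros Hf Hg. apply E in Hf. apply E in Hg. apply E.
  eapply filterlim_comp_2; [exact Hf | exact Hg | apply (@filterlim_mult C_AbsRing)].
Qed.

(** The expansion of the product is a hypothesis, so only its coefficients have to be compared:
    f = a_0 + t f_1 gives (f g - a_0 g) / t = f_1 g, and induction on the index applies to f_1. *)
Lemma has_germ_mult (a b c : nat -> C) (f g : C -> C) :
  has_germ a f -> has_germ b g -> has_germ c (fun t => f t * g t) ->
  forall n, c n = sum_n (fun k => a k * b (n - k)%nat) n.
Proof.
  intros Ha Hb Hc n. revert a c f Ha Hc.
  assert (E : forall a c f, has_germ a f -> has_germ c (fun t => f t * g t) ->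
    c 0%nat = a 0%nat * b 0%nat).
  { intros a c f Ha Hc.
    apply (@filterlim_locally_unique R C_AbsRing C_NormedModule (at_right 0)
      (Proper_StrongProper _ (at_right_proper_filter 0)) (fun s : R => f (s * 1) * g (s * 1))).
    - apply (filterlim_comp _ _ _ (fun s : R => s * 1) (fun t => f t * g t) _ _ _ (ray_locally' 1 C1_nz)).
      now apply has_germ_limit.
    - apply filterlim_Cmult.
      + apply at_right_proper_filter.
      + apply (filterlim_comp _ _ _ (fun s : R => s * 1) f _ _ _ (ray_locally' 1 C1_nz)).
        now apply has_germ_limit.
      + apply (filterlim_comp _ _ _ (fun s : R => s * 1) g _ _ _ (ray_locally' 1 C1_nz)).
        now apply has_germ_limit. }
  induction n as [|n IH]; intros a c f Ha Hc.
  - rewrite sum_O. now apply (E a c f).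
  - assert (Hd : has_germ (fun n => c (S n) - a 0%nat * b (S n)) (fun t => (f t - a 0%nat) / t * g t)).
    { assert (H := has_germ_peel _ _ (has_germ_lincomb (a 0%nat) _ _ _ _ Hc Hb)).
      revert H. apply has_germ_ext. apply filter_forall. intro t.
      rewrite (E a c f Ha Hc). unfold Cdiv. ring. }
    assert (H := IH _ _ _ (has_germ_peel _ _ Ha) Hd).
    unfold sum_n. rewrite sum_Sn_m by lia. rewrite <- sum_n_m_S.
    change (sum_n_m ?u 0 n) with (sum_n u n). simpl in H |- *.
    rewrite <- H. change plus with Cplus. ring.
Qed.

(** * Analytic functions on the slit plane *)

Lemma analytic_at_ball (f : C -> C) (z0 : C) :
  analytic_at f z0 <-> exists (a : nat -> C) (r : R), 0 < r /\
    forall u : C, Cmod u < r -> is_pseries a u (f (z0 + u)).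
Proof.
  split; intros [a H]; exists a.
  - apply locally_Cmod in H. destruct H as [r [Hr H]]. exists r. split; trivial.
    intros u Hu. replace u with (z0 + u - z0) at 1 by ring. apply H.
    now replace (z0 + u - z0) with u by ring.
  - destruct H as [r [Hr H]]. apply locally_Cmod. exists r. split; trivial.
    intros y Hy. replace y with (z0 + (y - z0)) at 2 by ring. now apply H.
Qed.

Lemma analytic_at_C_derive (f : C -> C) (z0 : C) :
  analytic_at f z0 -> analytic_at (C_derive f) z0 /\ is_cderive f z0 (C_derive f z0).
Proof.
  intro H. apply analytic_at_ball in H. destruct H as [a [r [Hr H]]].
  assert (H' : forall u, Cmod u < r ->
    is_pseries (PS_Cderive a) u (C_derive f (z0 + u)) /\ is_cderive f (z0 + u) (C_derive f (z0 + u))).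
  { intros u Hu. destruct (is_pseries_Cderive a (fun v => f (z0 + v)) r H u Hu) as [l [Hl Hd]].
    apply is_cderive_shift in Hd. rewrite (is_cderive_C_derive _ _ _ Hd). now split. }
  split.
  - apply analytic_at_ball. exists (PS_Cderive a), r. split; trivial. intros u Hu. now apply H'.
  - replace z0 with (z0 + 0) by ring. apply H'. now rewrite Cmod_0.
Qed.

Lemma analytic_at_lincomb (k : C) (f g : C -> C) (z0 : C) :
  analytic_at f z0 -> analytic_at g z0 -> analytic_at (fun z => f z - k * g z) z0.
Proof.
  intros [a Ha] [b Hb]. exists (fun n => a n - k * b n).
  generalize (filter_and (F := locally z0) _ _ Ha Hb). apply filter_imp. intros t [Hf Hg].
  now apply is_pseries_lincomb.
Qed.

Lemma analytic_at_id_mult (f : C -> C) (z0 : C) :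
  analytic_at f z0 -> analytic_at (fun z => z * f z) z0.
Proof.
  intros [a Ha]. exists (fun n => PS_incr_1 a n - (- z0) * a n).
  revert Ha. apply filter_imp. intros t Ht.
  replace (t * f t) with ((t - z0) * f t - (- z0) * f t) by ring.
  apply is_pseries_lincomb; [exact (is_pseries_incr_1 _ _ _ Ht) | exact Ht].
Qed.

(** The zeros on the segment from 0 to [z] start with an interval; at the end [T] of the largest such
    interval the local expansion vanishes on the side of the origin, hence identically, and the
    interval could be prolonged if [T] were less than 1. *)
Lemma analytic_zero_on_ray (h : C -> C) (z : C) :
  (forall t : R, 0 <= t <= 1 -> analytic_at h (t * z)) ->
  locally (RtoC 0) (fun w => h w = 0) -> h z = 0.
Proof.
  intros Han H0. apply locally_Cmod in H0. destruct H0 as [d [Hd H0]].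
  destruct (Ceq_dec z 0) as [->|Hz].
  { apply H0. replace (0 - 0) with (RtoC 0) by ring. now rewrite Cmod_0. }
  assert (Hz' := proj1 (Cmod_gt_0 z) Hz).
  set (E := fun t => 0 <= t <= 1 /\ forall s, 0 <= s <= t -> h (s * z) = 0).
  destruct (completeness E) as [T [Hub Hlub]].
  { exists 1%R. intros t [Ht _]. lra. }
  { exists 0%R. split; [lra|]. intros s Hs. apply H0. replace s with 0%R by lra.
    replace (RtoC 0 * z - 0) with (RtoC 0) by ring. now rewrite Cmod_0. }
  assert (HT1 : T <= 1) by (apply Hlub; intros t [Ht _]; lra).
  assert (HT0 : 0 < T).
  { set (e := Rmin 1 (d / (2 * Cmod z))).
    assert (He0 : 0 < e) by (apply Rmin_glb_lt; [lra | apply Rdiv_lt_0_compat; lra]).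
    apply Rlt_le_trans with (1 := He0). apply Hub. split.
    - split; [lra | apply Rmin_l].
    - intros s Hs. apply H0. replace (s * z - 0) with (s * z) by ring.
      rewrite Cmod_mult, Cmod_R, Rabs_pos_eq by lra.
      assert (Hs' : s <= d / (2 * Cmod z)) by (eapply Rle_trans; [apply Hs | apply Rmin_r]).
      apply (Rmult_le_compat_r (Cmod z)) in Hs'; [|lra].
      replace (d / (2 * Cmod z) * Cmod z)%R with (d / 2)%R in Hs' by (field; lra). lra. }
  assert (Hbelow : forall s, 0 <= s < T -> h (s * z) = 0).
  { intros s Hs. destruct (Classical_Prop.classic (exists t, E t /\ s < t)) as [[t [[_ Ht] Hst]]|Hn].
    - apply Ht. lra.
    - exfalso. assert (T <= s); [|lra]. apply Hlub. intros t Ht.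
      destruct (Rle_lt_dec t s); trivial. exfalso. apply Hn. now exists t. }
  destruct (proj1 (analytic_at_ball h (T * z)) (Han T ltac:(lra))) as [a [r [Hr Ha]]].
  (* Points T z + s (- z) with small s > 0 lie on the part of the ray where h vanishes. *)
  assert (Hcoef : forall n, a n = 0).
  { apply (has_germ_zero_on_ray (- z) a (fun u => h (T * z + u))).
    - intro Ez. apply Hz. replace z with (- - z) by ring. rewrite Ez. ring.
    - apply locally'_Cmod. exists r. split; trivial. intros u Hu _. apply Ha.
      now replace u with (u - 0) by ring.
    - exists (mkposreal T HT0). intros s Hs Hs0.
      change (Rabs (s - 0) < T) in Hs. rewrite Rminus_0_r, Rabs_pos_eq in Hs by lra.
      replace (T * z + s * - z) with ((T - s)%R * z) by (rewrite RtoC_minus; ring).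
      apply Hbelow. lra. }
  assert (Hnear : forall s : R, Rabs (s - T) < r / Cmod z -> h (s * z) = 0).
  { intros s Hs. apply (is_pseries_zero_coef a ((s - T)%R * z)); trivial.
    replace (s * z) with (T * z + (s - T)%R * z) by (rewrite RtoC_minus; ring).
    apply Ha. rewrite Cmod_mult, Cmod_R.
    apply (Rmult_lt_compat_r (Cmod z)) in Hs; trivial.
    replace (r / Cmod z * Cmod z)%R with r in Hs by (field; lra). exact Hs. }
  assert (Hrz : 0 < r / Cmod z) by (apply Rdiv_lt_0_compat; lra).
  destruct (Rle_lt_or_eq_dec T 1 HT1) as [HT|HT].
  - exfalso. set (e := Rmin 1 (T + r / Cmod z / 2)).
    assert (He : e <= T + r / Cmod z / 2) by apply Rmin_r.
    assert (He1 : T < e) by (apply Rmin_glb_lt; lra).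
    assert (e <= T); [|lra]. apply Hub. split; [split; [lra | apply Rmin_l]|].
    intros s Hs. destruct (Rlt_le_dec s T); [apply Hbelow; lra|].
    apply Hnear. rewrite Rabs_pos_eq; lra.
  - replace z with (1%R * z) by ring. apply Hnear. rewrite HT, Rminus_eq_0, Rabs_R0. exact Hrz.
Qed.

(** Star-shaped about the origin: continuation along the segments issued from 0 reaches all of it. *)
Definition slit (z : C) : Prop := ~ (1 <= Re z /\ Im z = 0%R).

Lemma slit_ray (z : C) (t : R) : slit z -> 0 <= t <= 1 -> slit (t * z).
Proof.
  intros Hz Ht [H1 H2]. apply Hz. destruct z as [x y]. cbn in *.
  assert (Ht0 : 0 < t) by (destruct (Rle_lt_or_eq_dec 0 t ltac:(lra)) as [|<-]; [trivial | lra]).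
  assert (Hx : 0 < x) by (apply (Rmult_lt_reg_l t); lra).
  split; [nra|]. apply (Rmult_eq_reg_l t); lra.
Qed.

(** Such an [f] is determined on the whole slit plane by [a], so identities between analytic
    continuations can be read off coefficients at the origin. *)
Definition slit_expansion (a : nat -> C) (f : C -> C) : Prop :=
  (forall z, slit z -> analytic_at f z) /\ locally (RtoC 0) (fun z => is_pseries a z (f z)).

Lemma slit_expansion_unique (a b : nat -> C) (f g : C -> C) (z : C) :
  slit_expansion a f -> slit_expansion b g -> (forall n, a n = b n) -> slit z -> f z = g z.
Proof.
  intros [Hf Ha] [Hg Hb] Hab Hz.
  assert (H : f z - 1 * g z = 0).
  { apply (analytic_zero_on_ray (fun z => f z - 1 * g z)).
    - intros t Ht. apply analytic_at_lincomb; [apply Hf | apply Hg]; now apply slit_ray.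
    - generalize (filter_and (F := locally (RtoC 0)) _ _ Ha Hb). apply filter_imp. intros t [H1 H2].
      apply (is_pseries_zero_coef (fun n => a n - 1 * b n) t).
      + intro n. rewrite Hab. ring.
      + now apply is_pseries_lincomb. }
  replace (g z) with (g z + (f z - 1 * g z)) by (rewrite H; ring). ring.
Qed.

Lemma slit_expansion_ext (a b : nat -> C) (f : C -> C) :
  (forall n, a n = b n) -> slit_expansion a f -> slit_expansion b f.
Proof.
  intros E [Hf Ha]. split; trivial. revert Ha. apply filter_imp. intros t.
  now apply is_pseries_ext.
Qed.

Lemma slit_expansion_lincomb (k : C) (a b : nat -> C) (f g : C -> C) :
  slit_expansion a f -> slit_expansion b g ->
  slit_expansion (fun n => a n - k * b n) (fun z => f z - k * g z).
Proof.
  intros [Hf Ha] [Hg Hb]. split.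
  - intros z Hz. apply analytic_at_lincomb; auto.
  - generalize (filter_and (F := locally (RtoC 0)) _ _ Ha Hb). apply filter_imp. intros t [H1 H2].
    now apply is_pseries_lincomb.
Qed.

Lemma slit_expansion_id_mult (a : nat -> C) (f : C -> C) :
  slit_expansion a f -> slit_expansion (PS_incr_1 a) (fun z => z * f z).
Proof.
  intros [Hf Ha]. split.
  - intros z Hz. apply analytic_at_id_mult; auto.
  - revert Ha. apply filter_imp. intros t Ht. exact (is_pseries_incr_1 _ _ _ Ht).
Qed.

Lemma slit_expansion_one : slit_expansion one_coef (fun _ => 1).
Proof.
  split.
  - intros z _. exists one_coef. apply filter_forall. intro w. apply is_pseries_one.
  - apply filter_forall. apply is_pseries_one.
Qed.

(** The operator z d/dz multiplies the n-th coefficient by n, hence lowers the order of a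
    polylogarithm by one. *)
Lemma slit_expansion_euler (a : nat -> C) (f : C -> C) :
  slit_expansion a f -> slit_expansion (fun n => INR n * a n) (fun z => z * C_derive f z).
Proof.
  intros [Hf Ha]. split.
  - intros z Hz. now apply analytic_at_id_mult, analytic_at_C_derive, Hf.
  - apply locally_Cmod in Ha. destruct Ha as [r [Hr Ha]]. apply locally_Cmod. exists r. split; trivial.
    assert (Ha' : forall z, Cmod z < r -> is_pseries a z (f z)).
    { intros z Hz. apply Ha. now replace (z - 0) with z by ring. }
    intros z Hz. replace (z - 0) with z in Hz by ring.
    destruct (is_pseries_Cderive a f r Ha' z Hz) as [l [Hl Hd]].
    rewrite (is_cderive_C_derive _ _ _ Hd). apply is_pseries_incr_1 in Hl. revert Hl.
    apply is_pseries_ext. intros [|n]; [|reflexivity].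
    change (RtoC 0 = 0 * a 0%nat). ring.
Qed.

(** * Polylogarithms of all orders on the slit plane *)

Definition polylog_coef (n k : nat) : C :=
  match k with O => 0 | S _ => / RtoC (INR k ^ n) end.

Lemma polylog_coef_S (n k : nat) : INR k * polylog_coef (S n) k = polylog_coef n k.
Proof.
  destruct k as [|k]; [apply Cmult_0_l|]. unfold polylog_coef.
  assert (H := not_0_INR (S k) ltac:(lia)).
  assert (H' : RtoC (INR (S k)) <> 0) by (intro E; apply H, RtoC_inj, E).
  assert (H'' : RtoC (INR (S k) ^ n) <> 0).
  { intro E. apply RtoC_inj in E. revert E. now apply pow_nonzero. }
  replace (INR (S k) ^ S n)%R with (INR (S k) * INR (S k) ^ n)%R by reflexivity.
  rewrite RtoC_mult. field. split; assumption.
Qed.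

Lemma is_polylog_expansion (n : nat) (f : C -> C) :
  is_polylog n f -> slit_expansion (polylog_coef n) f.
Proof.
  intros [H1 H2]. split; [exact H2|].
  apply locally_Cmod. exists 1%R. split; [lra|]. intros z Hz.
  replace (z - 0) with z in Hz by ring.
  apply is_pseries_C. apply (is_series_decr_1 (K := C_AbsRing) (V := C_NormedModule)).
  replace (plus (f z) _) with (f z).
  - generalize (H1 z (Rlt_le _ _ Hz)). apply is_series_ext. intro k. unfold Cdiv. apply Cmult_comm.
  - change (f z = f z + - (0 * 1)). ring.
Qed.

(** The ladder z Li_(n+1)' = Li_n is continued down to the rational function of order 0, where the
    inversion formula is an identity of fractions. The function of order 1, which is - log (1 - z),
    is obtained from the one of order 2, and so inherits its analyticity on the slit plane. *)
Definition polylog_ext (Li : nat -> C -> C) (n : nat) (z : C) : C :=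
  match n with
  | 0%nat => z / (1 - z)
  | 1%nat => z * C_derive (Li 2%nat) z
  | _ => Li n z
  end.

Lemma slit_1 (z : C) : slit z -> 1 - z <> 0.
Proof.
  intros Hz E. apply Hz. replace z with (RtoC 1); [cbn; split; lra|].
  replace (RtoC 1) with (1 - z + z) by ring. rewrite E. ring.
Qed.

Lemma polylog_ext_expansion (Li : nat -> C -> C) :
  (forall n : nat, (2 <= n)%nat -> is_polylog n (Li n)) ->
  forall n, slit_expansion (polylog_coef (S n)) (polylog_ext Li (S n)).
Proof.
  intros HLi [|n].
  - apply (slit_expansion_ext (fun k => INR k * polylog_coef 2 k)).
    + intro k. apply polylog_coef_S.
    + apply slit_expansion_euler, is_polylog_expansion, HLi. lia.
  - apply is_polylog_expansion, HLi. lia.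
Qed.

Lemma polylog_ext_derive (Li : nat -> C -> C) :
  (forall n : nat, (2 <= n)%nat -> is_polylog n (Li n)) ->
  forall n z, slit z -> 
  exists l : C, is_cderive (polylog_ext Li (S n)) z l /\ z * l = polylog_ext Li n z.
Proof.
  intros HLi n z Hz.
  assert (H := polylog_ext_expansion Li HLi n).
  exists (C_derive (polylog_ext Li (S n)) z). split; [apply analytic_at_C_derive, H, Hz|].
  apply slit_expansion_euler in H.
  apply (slit_expansion_ext _ (polylog_coef n)) in H; [|intro k; apply polylog_coef_S].
  destruct n as [|n].
  - (* Clearing the denominator keeps everything analytic: (1 - z) g has the expansion of z. *)
    set (g := fun z => z * C_derive (polylog_ext Li 1) z) in *.
    assert (Hg := slit_expansion_lincomb 1 _ _ _ _ H (slit_expansion_id_mult _ _ H)).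
    assert (E : g z - 1 * (z * g z) = z * 1).
    { apply (slit_expansion_unique _ _ _ _ z Hg (slit_expansion_id_mult _ _ slit_expansion_one)); trivial.
      intros [|[|k]]; unfold PS_incr_1, polylog_coef.
      - change (0 - 1 * 0 = 0). ring.
      - change (/ 1 - 1 * 0 = 1). field.
      - change (/ 1 - 1 * / 1 = 0). field. }
    assert (H1 := slit_1 z Hz).
    change (g z = z / (1 - z)).
    replace (g z) with ((g z - 1 * (z * g z)) / (1 - z)) by (field; trivial).
    rewrite E. field. trivial.
  - exact (slit_expansion_unique _ _ _ _ z H (polylog_ext_expansion Li HLi n) (fun _ => eq_refl) Hz).
Qed.

(** * The complex exponential *)

Lemma Cexp_plus (u v : C) : Cexp (u + v) = Cexp u * Cexp v.
Proof.
  destruct u as [a b], v as [c d]. unfold Cexp. cbn. 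
  rewrite exp_plus, cos_plus, sin_plus. apply injective_projections; cbn; ring.
Qed.

Lemma Cexp_0 : Cexp 0 = 1.
Proof.
  unfold Cexp. cbn. rewrite exp_0, cos_0, sin_0. apply injective_projections; cbn; ring.
Qed.

Lemma Cexp_opp_r (z : C) : Cexp z * Cexp (- z) = 1.
Proof. rewrite <- Cexp_plus, <- Cexp_0. f_equal. ring. Qed.

Lemma Cexp_neq_0 (z : C) : Cexp z <> 0.
Proof.
  intro E. apply C1_nz. rewrite <- (Cexp_opp_r z), E. ring.
Qed.

Lemma Cexp_opp (z : C) : Cexp (- z) = / Cexp z.
Proof.
  assert (H := Cexp_neq_0 z). 
  replace (Cexp (- z)) with (Cexp z * Cexp (- z) * / Cexp z) by (field; trivial).
  rewrite Cexp_opp_r. ring.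
Qed.

Lemma RtoC_exp (a : R) : Cexp a = exp a.
Proof. unfold Cexp. cbn. rewrite cos_0, sin_0. apply injective_projections; cbn; ring. Qed.

Lemma Cmod_Cexp (a b : R) : Cmod (Cexp (a, b)) = exp a.
Proof.
  unfold Cexp, Cmod. cbn. 
  replace (_ + _)%R with (exp a * exp a)%R.
  - rewrite sqrt_square; trivial. left. apply exp_pos.
  - generalize (sin2_cos2 b). unfold Rsqr. intro H.
    replace (exp a * exp a)%R with (exp a * exp a * (sin b * sin b + cos b * cos b))%R by (rewrite H; ring). ring.
Qed.

Lemma Cmod_le_abs (x y : R) : Cmod (x, y) <= Rabs x + Rabs y.
Proof.
  replace (x, y) with (RtoC x + Ci * RtoC y) by (apply injective_projections; cbn; ring).
  eapply Rle_trans; [apply Cmod_triangle|]. rewrite Cmod_mult, !Cmod_R, Cmod_Ci. lra.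
Qed.

Lemma exp_quadratic (a : R) : a <= / 2 -> Rabs (exp a - 1 - a) <= 2 * (a * a).
Proof.
  intro Ha. assert (H1 := exp_ineq1_le a). assert (H2 := exp_ineq1_le (- a)).
  assert (H3 : (exp a * exp (- a) = 1)%R) by (rewrite <- exp_plus, Rplus_opp_r; apply exp_0).
  assert (H4 := exp_pos a).
  (* 1 - a <= exp (- a), and (1 + a + 2 a^2) (1 - a) >= 1 as soon as a <= 1/2. *)
  assert (H5 : exp a * (1 - a) <= 1) by nra.
  assert (H6 : exp a <= 1 + a + 2 * (a * a)).
  { apply (Rmult_le_reg_r (1 - a)); [lra|]. eapply Rle_trans; [exact H5|]. nra. }
  apply Rabs_le. nra.
Qed.

Lemma Rabs_sin_le (b : R) : Rabs (sin b) <= Rabs b.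
Proof.
  destruct (MVT_gen sin 0 b cos) as [c [_ Hc]].
  - intros x _. auto_derive; trivial. ring.
  - intros x _. apply continuity_sin.
  - rewrite sin_0, !Rminus_0_r in Hc. rewrite Hc, Rabs_mult.
    assert (Hb := Rabs_pos b).
    assert (Rabs (cos c) <= 1) by (apply Rabs_le, COS_bound). nra.
Qed.

Lemma cos_quadratic (b : R) : 0 <= 1 - cos b <= b * b.
Proof.
  assert (E : cos b = (1 - 2 * (sin (b / 2) * sin (b / 2)))%R).
  { replace b with (2 * (b / 2))%R at 1 by field. rewrite cos_2a_sin. ring. }
  assert (H := Rabs_sin_le (b / 2)). apply Rsqr_le_abs_1 in H. unfold Rsqr in H. nra.
Qed.

Lemma sin_quadratic (b : R) : Rabs b <= 1 -> Rabs (sin b - b) <= b * b.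
Proof.
  intro Hb.
  destruct (MVT_gen (fun x => sin x - x)%R 0 b (fun x => cos x - 1)%R) as [c [Hc1 Hc]].
  - intros x _. auto_derive; trivial. ring.
  - intros x _. apply derivable_continuous_pt. 
    apply derivable_pt_minus; [apply derivable_pt_sin | apply derivable_pt_id].
  - rewrite sin_0, !Rminus_0_r in Hc. rewrite Hc, Rabs_mult.
    assert (H := cos_quadratic c).
    assert (Hcb : c * c <= b * b) by (revert Hc1; unfold Rmin, Rmax; destruct (Rle_dec 0 b); nra).
    assert (Hbb : b * b <= 1) by (apply Rabs_le_between in Hb; nra).
    rewrite (Rabs_minus_sym (cos c)), Rabs_pos_eq by lra. 
    replace (b * b)%R with (Rabs b * Rabs b)%R in * by (rewrite <- Rabs_mult; apply Rabs_pos_eq; nra).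
    assert (H0 := Rabs_pos b). nra.
Qed.

Lemma Cexp_quadratic (h : C) : Cmod h < / 2 -> Cmod (Cexp h - 1 - h) <= 7 * (Cmod h * Cmod h).
Proof.
  intro Hh. assert (Ha := Rabs_Re_le h). assert (Hb := Rabs_Im_le h).
  destruct h as [a b]. set (m := Cmod (a, b)) in *. cbn in Ha, Hb.
  replace (Cexp (a, b) - 1 - (a, b)) with ((exp a * cos b - 1 - a)%R, (exp a * sin b - b)%R)
    by (apply injective_projections; cbn; ring).
  eapply Rle_trans; [apply Cmod_le_abs|].
  assert (Haa : a <= / 2) by (generalize (Rle_abs a); lra).
  assert (H1 := exp_quadratic a Haa). assert (H2 := cos_quadratic b).
  assert (H3 := sin_quadratic b ltac:(lra)). assert (H4 := Rabs_sin_le b).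
  assert (H5 : Rabs (cos b) <= 1) by (apply Rabs_le, COS_bound).
  assert (P1 := Rabs_pos a). assert (P2 := Rabs_pos b).
  assert (Ea : (a * a = Rabs a * Rabs a)%R) by (rewrite <- Rabs_mult, Rabs_pos_eq; nra).
  assert (Eb : (b * b = Rabs b * Rabs b)%R) by (rewrite <- Rabs_mult, Rabs_pos_eq; nra).
  rewrite Ea in H1. rewrite Eb in H2, H3.
  assert (A1 : Rabs (exp a * cos b - 1 - a) <= 2 * (Rabs a * Rabs a) + 3 / 2 * (Rabs b * Rabs b)).
  { replace (exp a * cos b - 1 - a)%R with ((exp a - 1 - a) * cos b + (1 + a) * (cos b - 1))%R by ring.
    eapply Rle_trans; [apply Rabs_triang|]. rewrite !Rabs_mult.
    apply Rplus_le_compat.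
    - generalize (Rabs_pos (exp a - 1 - a)) (Rabs_pos (cos b)). nra.
    - apply Rmult_le_compat; try apply Rabs_pos.
      + eapply Rle_trans; [apply Rabs_triang|]. rewrite Rabs_R1. lra.
      + rewrite Rabs_minus_sym, Rabs_pos_eq; lra. }
  assert (A2 : Rabs (exp a * sin b - b) <= 2 * Rabs a * Rabs b + Rabs b * Rabs b).
  { replace (exp a * sin b - b)%R with ((exp a - 1) * sin b + (sin b - b))%R by ring.
    eapply Rle_trans; [apply Rabs_triang|]. rewrite Rabs_mult.
    apply Rplus_le_compat; trivial. apply Rmult_le_compat; try apply Rabs_pos; trivial.
    replace (exp a - 1)%R with ((exp a - 1 - a) + a)%R by ring.
    eapply Rle_trans; [apply Rabs_triang|]. nra. }
  assert (B1 : Rabs a * Rabs a <= m * m) by nra.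
  assert (B2 : Rabs b * Rabs b <= m * m) by nra.
  assert (B3 : Rabs a * Rabs b <= m * m) by (apply Rmult_le_compat; trivial).
  lra.
Qed.

Lemma is_cderive_Cexp (z : C) : is_cderive Cexp z (Cexp z).
Proof.
  apply is_cderive_quadratic with (K := (Cmod (Cexp z) * 7)%R) (d := (/ 2)%R); [lra|].
  intros h Hh. rewrite Cexp_plus.
  replace (Cexp z * Cexp h - Cexp z - h * Cexp z) with (Cexp z * (Cexp h - 1 - h)) by ring.
  rewrite Cmod_mult, Rmult_assoc. apply Rmult_le_compat_l; [apply Cmod_ge_0|].
  now apply Cexp_quadratic.
Qed.

(** The sum [E] of the series satisfies E' = E, so E(z) exp(-z) is constant. *)
Lemma is_pseries_Cexp (z : C) : is_pseries (fun n => / INR (fact n) : C) z (Cexp z).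
Proof.
  set (a := fun n => / INR (fact n) : C).
  assert (Hex : forall w : C, exists l : C, is_pseries a w l).
  { intro w. assert (H : exists l : C, is_series (fun n => a n * w ^ n) l).
    { apply (@ex_series_le C_AbsRing C_CompleteNormedModule) with
        (b := fun n => (/ INR (fact n) * Cmod w ^ n)%R).
      - intro n. change (norm (a n * w ^ n : C_CompleteNormedModule)) with (Cmod (a n * w ^ n)).
        assert (Hf := INR_fact_lt_0 n).
        unfold a. rewrite Cmod_mult, Cmod_pow, Cmod_inv by (apply RtoC_neq_0; lra).
        rewrite Cmod_R, Rabs_pos_eq by lra. apply Rle_refl.
      - exists (exp (Cmod w)). apply is_pseries_R, is_exp_Reals. }
    destruct H as [l Hl]. exists l. now apply is_pseries_C. }
  destruct (functional_choice _ Hex) as [E HE].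
  assert (HdE : forall w, is_cderive E w (E w)).
  { intro w.
    destruct (is_pseries_Cderive a E (Cmod w + 1)%R (fun w _ => HE w) w (Rlt_plus_1 _)) as [l [Hl Hd]].
    replace (E w) with l; trivial. apply (is_pseries_C_unique a w); [|apply HE].
    revert Hl. apply is_pseries_ext. intro n. unfold PS_Cderive, a.
    rewrite fact_simpl, mult_INR, RtoC_mult.
    assert (H1 := RtoC_neq_0 _ (not_0_INR (S n) ltac:(lia))).
    assert (H2 := RtoC_neq_0 _ (INR_fact_neq_0 n)). Cfield. now split. }
  (* E z * exp (- z) is constant, as its derivative is E z exp (- z) - E z exp (- z). *)
  assert (H : E z * Cexp (- z) = E 0 * Cexp (- 0)).
  { apply (zero_cderive_segment (fun w => E w * Cexp (- w))). intros t _.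
    set (w := 0 + t * (z - 0)).
    assert (Hm : is_cderive (fun w => - w) w (- (1))).
    { generalize (is_cderive_linear (- (1)) w). apply is_cderive_ext. intro u. ring. }
    assert (H := is_cderive_mult _ _ _ _ _ (HdE w) (is_cderive_comp Cexp _ w _ _ (is_cderive_Cexp (- w)) Hm)).
    now replace (RtoC 0) with (E w * Cexp (- w) + E w * (- (1) * Cexp (- w))) by ring. }
  replace (- 0) with (RtoC 0) in H by ring.
  replace (E 0) with (RtoC 1) in H.
  2:{ symmetry. apply (is_pseries_C_unique a 0); [apply HE|].
      replace (RtoC 1) with (a 0%nat); [exact (is_pseries_0 a)|]. unfold a. simpl. field. }
  rewrite Cexp_0 in H.
  replace (Cexp z) with (E z); [apply HE|].
  replace (E z) with (E z * (Cexp z * Cexp (- z))) by (rewrite Cexp_opp_r; ring).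
  replace (E z * (Cexp z * Cexp (- z))) with (Cexp z * (E z * Cexp (- z))) by ring.
  rewrite H. ring.
Qed.

Lemma Cexp_neq_1 (t : C) : Cmod t < 1 -> t <> 0 -> Cexp t - 1 <> 0.
Proof.
  intros Ht Ht0 E. apply Ht0.
  assert (Hb := Rabs_Im_le t). destruct t as [a b]. cbn in Hb.
  assert (H1 : (exp a * cos b = 1)%R) by (apply (f_equal fst) in E; cbn in E; lra).
  assert (H2 : (exp a * sin b = 0)%R) by (apply (f_equal snd) in E; cbn in E; lra).
  assert (H3 := exp_pos a). assert (H4 := PI2_1).
  assert (Hs : sin b = 0%R) by (apply (Rmult_eq_reg_l (exp a)); lra).
  assert (Hb0 : b = 0%R).
  { apply Rabs_le_between in Hb.
    destruct (Rtotal_order b 0) as [Hlt|[->|Hgt]]; trivial; exfalso.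
    - assert (0 < sin (- b)) by (apply sin_gt_0; lra). rewrite sin_neg in *. lra.
    - assert (0 < sin b) by (apply sin_gt_0; lra). lra. }
  subst b. rewrite cos_0, Rmult_1_r in H1. rewrite <- exp_0 in H1. apply exp_inv in H1. now subst a.
Qed.

Lemma near_0_Cexp_neq_1 : locally' (RtoC 0) (fun t => Cexp t - 1 <> 0).
Proof.
  apply locally'_Cmod. exists 1%R. split; [lra|]. intros t Ht Ht0.
  apply Cexp_neq_1; trivial. now replace t with (t - 0) by ring.
Qed.

Lemma Cexp_Clog (x : C) : x <> 0 -> 0 <= Im x -> Cexp (Clog x) = x.
Proof.
  intros Hx0 Hx. assert (Hm := proj1 (Cmod_gt_0 x) Hx0).
  assert (Hre := Rabs_Re_le x). apply Rabs_le_between in Hre.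
  assert (Hu : -1 <= Re x / Cmod x <= 1).
  { split; apply (Rmult_le_reg_r (Cmod x)); trivial;
      replace (Re x / Cmod x * Cmod x)%R with (Re x) by (field; lra); lra. }
  unfold Clog, Carg. destruct (Rle_dec 0 (Im x)) as [_|]; [|contradiction].
  unfold Cexp. cbn [Re Im fst snd]. rewrite exp_ln, cos_acos, sin_acos by trivial.
  replace (sqrt (1 - Rsqr (Re x / Cmod x))) with (Im x / Cmod x)%R.
  - destruct x as [a b]. apply injective_projections; cbn [fst snd Re Im]; field; lra.
  - symmetry. apply sqrt_lem_1.
    + unfold Rsqr. nra.
    + apply Rdiv_le_0_compat; lra.
    + assert (E : (Cmod x * Cmod x = Re x * Re x + Im x * Im x)%R).
      { unfold Cmod. rewrite sqrt_sqrt; [unfold Re, Im; ring|]. nra. }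
      unfold Rsqr. apply (Rmult_eq_reg_r (Cmod x * Cmod x)); [|nra].
      field_simplify; [|lra | lra]. nra.
Qed.

(** * Bernoulli polynomials divided by factorials *)

Lemma sum_n_C_S (a : nat -> C) (n : nat) : sum_n a (S n) = sum_n a n + a (S n) :> C.
Proof. apply (sum_Sn a n). Qed.

Lemma sum_n_C_shift (a : nat -> C) (n : nat) : sum_n a (S n) = a 0%nat + sum_n (fun k => a (S k)) n :> C.
Proof.
  induction n as [|n IH].
  - rewrite sum_n_C_S, !sum_O. reflexivity.
  - rewrite sum_n_C_S, IH, sum_n_C_S. ring.
Qed.

Lemma is_cderive_sum_n (g dg : nat -> C -> C) (z : C) (n : nat) :
  (forall k, is_cderive (g k) z (dg k z)) ->
  is_cderive (fun w => sum_n (fun k => g k w) n : C) z (sum_n (fun k => dg k z) n : C).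
Proof.
  intro H. induction n as [|n IH].
  - rewrite sum_O. apply (is_cderive_ext (g 0%nat)); [|apply H]. intro w. now rewrite sum_O.
  - rewrite sum_n_C_S.
    generalize (is_cderive_plus _ _ _ _ _ IH (H (S n))). apply is_cderive_ext.
    intro w. symmetry. apply sum_n_C_S.
Qed.

Lemma is_cderive_pow (n : nat) (z : C) : is_cderive (fun w => w ^ S n) z (INR (S n) * z ^ n).
Proof.
  induction n as [|n IH].
  - generalize (is_cderive_linear 1 z). replace (INR 1 * z ^ 0) with (RtoC 1) by (simpl; ring).
    apply is_cderive_ext. intro w. simpl. Cring.
  - generalize (is_cderive_mult _ _ _ _ _ (is_cderive_id z) IH).
    replace (1 * z ^ S n + z * (INR (S n) * z ^ n)) with (INR (S (S n)) * z ^ S n)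
      by (rewrite (S_INR (S n)), RtoC_plus, !Cpow_S; ring).
    apply is_cderive_ext. intro w. reflexivity.
Qed.

Lemma RtoC_fact_neq_0 (n : nat) : RtoC (INR (fact n)) <> 0.
Proof. apply RtoC_neq_0, INR_fact_neq_0. Qed.

(** The coefficient of t^n in exp(x t) times the series with coefficients [b]. *)
Definition appell (b : nat -> C) (n : nat) (x : C) : C :=
  sum_n (fun k => x ^ k / INR (fact k) * b (n - k)%nat) n.

(** The divided powers x^k / k! differentiate to one another. *)
Lemma appell_derive (b : nat -> C) (n : nat) (x : C) :
  is_cderive (appell b (S n)) x (appell b n x).
Proof.
  unfold appell.
  assert (H : forall k, is_cderive (fun w => w ^ S k / INR (fact (S k)) * b (n - k)%nat) x
    (x ^ k / INR (fact k) * b (n - k)%nat)).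
  { intro k.
    generalize (is_cderive_mult _ _ _ _ _ (is_cderive_const (/ INR (fact (S k)) * b (n - k)%nat) x) (is_cderive_pow k x)).
    match goal with |- is_cderive _ _ ?l -> is_cderive _ _ ?m => replace l with m end.
    - apply is_cderive_ext. intro w. unfold Cdiv. Cring.
    - rewrite fact_simpl, mult_INR, RtoC_mult.
      assert (H1 := RtoC_neq_0 _ (not_0_INR (S k) ltac:(lia))).
      assert (H2 := RtoC_fact_neq_0 k). field. now split. }
  (* The term k = 0 of order n + 1 is constant; the others are shifted by one. *)
  apply (is_cderive_sum_n (fun k w => w ^ S k / INR (fact (S k)) * b (n - k)%nat)
    (fun k w => w ^ k / INR (fact k) * b (n - k)%nat) x n) in H.
  assert (H' := is_cderive_plus _ _ _ _ _ (is_cderive_const (1 / INR (fact 0) * b (S n)) x) H).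
  rewrite Cplus_0_l in H'. revert H'. apply is_cderive_ext. intro w.
  symmetry. apply (sum_n_C_shift (fun k => w ^ k / INR (fact k) * b (S n - k)%nat)).
Qed.

(** With this normalisation the derivative of the n-th polynomial is the previous one, exactly as for
    the polylogarithms in the variable log x. *)
Definition scaled_bernoulli (B : nat -> C -> C) (n : nat) (x : C) : C := B n x / INR (fact n).

Lemma scaled_bernoulli_germ (B : nat -> C -> C) (x : C) :
  is_bernoulli B ->
  has_germ (fun n => scaled_bernoulli B n x) (fun t => t * Cexp (x * t) / (Cexp t - 1)).
Proof. intro hB. exact (hB x). Qed.

(** The generating function at [x] is exp(x t) times the one at 0. *)
Lemma scaled_bernoulli_appell (B : nat -> C -> C) :
  is_bernoulli B ->
  forall n x, scaled_bernoulli B n x = appell (fun k => scaled_bernoulli B k 0) n x.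
Proof.
  intros hB n x.
  apply (has_germ_mult (fun k => x ^ k / INR (fact k)) (fun k => scaled_bernoulli B k 0)
    (fun k => scaled_bernoulli B k x) (fun t => Cexp (x * t)) (fun t => t * Cexp (0 * t) / (Cexp t - 1))).
  - apply locally'_Cmod. exists 1%R. split; [lra|]. intros t _ _.
    generalize (is_pseries_Cexp (x * t)). intro H. apply is_pseries_C in H. apply is_pseries_C.
    revert H. apply is_series_ext. intro k. rewrite Cpow_mult_l. unfold Cdiv. Cring.
  - now apply scaled_bernoulli_germ.
  - generalize (scaled_bernoulli_germ B x hB). apply has_germ_ext. apply filter_forall. intro t.
    rewrite Cmult_0_l, Cexp_0. unfold Cdiv. ring.
Qed.

Lemma scaled_bernoulli_derive (B : nat -> C -> C) :
  is_bernoulli B ->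
  forall n x, is_cderive (scaled_bernoulli B (S n)) x (scaled_bernoulli B n x).
Proof.
  intros hB n x. rewrite (scaled_bernoulli_appell B hB).
  generalize (appell_derive (fun k => scaled_bernoulli B k 0) n x). apply is_cderive_ext. intro w.
  symmetry. now apply scaled_bernoulli_appell.
Qed.

(** The generating functions at 1 and at 0 differ by t (e^t - 1) / (e^t - 1) = t. *)
Lemma scaled_bernoulli_diff (B : nat -> C -> C) :
  is_bernoulli B ->
  forall n, scaled_bernoulli B n 1 - 1 * scaled_bernoulli B n 0 = PS_incr_1 one_coef n.
Proof.
  intros hB n.
  apply (has_germ_unique (fun n => scaled_bernoulli B n 1 - 1 * scaled_bernoulli B n 0) (PS_incr_1 one_coef) (fun t => t * 1)).
  - generalize (has_germ_lincomb 1 _ _ _ _ (scaled_bernoulli_germ B 1 hB) (scaled_bernoulli_germ B 0 hB)).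
    apply has_germ_ext. generalize near_0_Cexp_neq_1. apply filter_imp. intros t Ht.
    rewrite Cmult_0_l, Cexp_0, Cmult_1_l. field. trivial.
  - apply locally'_Cmod. exists 1%R. split; [lra|]. intros t _ _.
    exact (is_pseries_incr_1 _ _ _ (is_pseries_one t)).
Qed.

Lemma scaled_bernoulli_0 (B : nat -> C -> C) :
  is_bernoulli B -> forall x, scaled_bernoulli B 0 x = 1.
Proof.
  intros hB x. assert (H := scaled_bernoulli_diff B hB 1).
  (* In beta_1(1) - beta_1(0) = 1 the left side is beta_0(0). *)
  rewrite !(scaled_bernoulli_appell B hB) in *. unfold appell in *.
  rewrite !sum_n_C_S, !sum_O in *. cbn -[scaled_bernoulli Cdiv] in *.
  etransitivity; [|exact H]. field.
Qed.

(** Replacing x by 1 - x in the generating function amounts to replacing t by -t. *)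
Lemma scaled_bernoulli_reflection (B : nat -> C -> C) :
  is_bernoulli B ->
  forall n x, scaled_bernoulli B n (1 - x) = (- (1)) ^ n * scaled_bernoulli B n x.
Proof.
  intros hB n x.
  apply (has_germ_unique (fun n => scaled_bernoulli B n (1 - x)) (fun n => (- (1)) ^ n * scaled_bernoulli B n x)
    (fun t => t * Cexp ((1 - x) * t) / (Cexp t - 1))); [now apply scaled_bernoulli_germ|].
  generalize (has_germ_opp _ _ (scaled_bernoulli_germ B x hB)).
  apply has_germ_ext. generalize near_0_Cexp_neq_1. apply filter_imp. intros t Ht.
  replace ((1 - x) * t) with (t + x * - t) by ring.
  rewrite Cexp_plus, (Cexp_opp t). assert (H := Cexp_neq_0 t).
  field. repeat split; trivial. intro E. apply Ht.
  replace (Cexp t - 1) with (- (1 - Cexp t)) by ring. rewrite E. ring.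
Qed.

Lemma Cpow_opp_1_even (m : nat) : (- (1)) ^ (2 * m) = 1.
Proof.
  rewrite Cpow_mult_r. replace ((- (1)) ^ 2) with (RtoC 1) by (simpl; ring). apply Cpow_1_l.
Qed.

Lemma C_self_opp (c : C) : c = - c -> c = 0.
Proof.
  intro E. replace c with ((c + c) / 2) by (field; apply RtoC_neq_0; lra).
  rewrite E at 2. unfold Cdiv. ring.
Qed.

Lemma scaled_bernoulli_odd_half (B : nat -> C -> C) :
  is_bernoulli B -> forall m, scaled_bernoulli B (2 * m + 1) (/ 2) = 0.
Proof.
  intros hB m. assert (H := scaled_bernoulli_reflection B hB (2 * m + 1) (/ 2)).
  rewrite Cpow_add_r, Cpow_opp_1_even in H.
  replace (1 - / 2) with (/ 2) in H by (field; apply RtoC_neq_0; lra).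
  apply C_self_opp. rewrite H at 1. simpl. ring.
Qed.

(** Reflection makes the values at 0 and 1 opposite, while they are equal from order 2 on. *)
Lemma scaled_bernoulli_odd_0 (B : nat -> C -> C) :
  is_bernoulli B -> forall m, scaled_bernoulli B (2 * m + 3) 0 = 0.
Proof.
  intros hB m. assert (H := scaled_bernoulli_reflection B hB (2 * m + 3) 0).
  assert (H1 := scaled_bernoulli_diff B hB (2 * m + 3)).
  rewrite Cpow_add_r, Cpow_opp_1_even in H.
  replace (1 - 0) with (RtoC 1) in H by ring. rewrite H in H1.
  replace (2 * m + 3)%nat with (S (S (2 * m + 1))) in * by lia. 
  change (PS_incr_1 one_coef (S (S (2 * m + 1)))) with (RtoC 0) in H1.
  set (c := scaled_bernoulli B _ 0) in *.
  apply C_self_opp. replace (- c) with (c + (1 * (- (1)) ^ 3 * c - 1 * c)) by (simpl; ring).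
  rewrite H1. ring.
Qed.

(** * Boundary values of polylogarithms *)

Lemma is_series_telescope (M : R) : 0 < M ->
  is_series (fun k => / ((M + INR k) * (M + INR k + 1)))%R (/ M)%R.
Proof.
  intro HM.
  assert (E : forall n, sum_n (fun k => / ((M + INR k) * (M + INR k + 1)))%R n
    = (/ M - / (M + INR n + 1))%R :> R).
  { induction n as [|n IH].
    - rewrite sum_O. simpl. field. lra.
    - rewrite sum_Sn, IH, S_INR. change plus with Rplus.
      match goal with |- @eq _ ?a ?b => change (@eq R a b) end.
      assert (H := pos_INR n). field. repeat split; lra. }
  change (is_lim_seq (sum_n (fun k => / ((M + INR k) * (M + INR k + 1)))%R) (/ M)%R).
  apply (is_lim_seq_ext (fun n => / M - / (M + INR n + 1))%R); [intro n; now rewrite E|].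
  replace (Finite (/ M)) with (Finite (/ M - 0)) by (f_equal; ring).
  apply is_lim_seq_minus'; [apply is_lim_seq_const|].
  replace (Finite 0) with (Rbar_inv p_infty) by reflexivity.
  apply is_lim_seq_inv; [|discriminate].
  apply (is_lim_seq_le_p_loc INR); [|apply is_lim_seq_INR].
  exists 0%nat. intros n _. lra.
Qed.

Lemma Cmod_pow_le_1 (z : C) (n : nat) : Cmod z <= 1 -> Cmod (z ^ n) <= 1.
Proof.
  intro Hz. rewrite Cmod_pow. rewrite <- (pow1 n). apply pow_incr. split; [apply Cmod_ge_0 | exact Hz].
Qed.

Lemma Cpow_lipschitz (z w : C) (n : nat) :
  Cmod z <= 1 -> Cmod w <= 1 -> Cmod (z ^ n - w ^ n) <= INR n * Cmod (z - w).
Proof.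
  intros Hz Hw. induction n as [|n IH].
  - simpl. replace (1 - 1) with (RtoC 0) by ring. rewrite Cmod_0. lra.
  - replace (z ^ S n - w ^ S n) with (z * (z ^ n - w ^ n) + (z - w) * w ^ n) by (rewrite !Cpow_S; ring).
    eapply Rle_trans; [apply Cmod_triangle|]. rewrite !Cmod_mult, S_INR.
    assert (H := Cmod_pow_le_1 w n Hw).
    assert (H1 := Cmod_ge_0 (z ^ n - w ^ n)). assert (H2 := Cmod_ge_0 (z - w)). assert (H3 := Cmod_ge_0 z).
    nra.
Qed.

(** Each of the first terms moves by at most |z - w|, as |z^k - w^k| <= k |z - w|, and the others are
    bounded by 2 / k^2, whose tail is compared with a telescoping series. *)
Lemma is_polylog_continuous_disk (n : nat) (f : C -> C) (w : C) :
  (2 <= n)%nat -> is_polylog n f -> Cmod w <= 1 ->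
  filterlim f (within (fun z => Cmod z <= 1) (locally w)) (locally (f w)).
Proof.
  intros Hn [Hf _] Hw P HP. apply locally_Cmod in HP. destruct HP as [eps [Heps HP]].
  (* The terms of index above N contribute at most 4 / (N + 2), which is below eps / 2. *)
  destruct (nfloor_ex (8 / eps)) as [N [_ HN]]; [apply Rdiv_le_0_compat; lra|].
  assert (HN0 := pos_INR N).
  apply locally_Cmod. exists (eps / (2 * (INR N + 1)))%R.
  split; [apply Rdiv_lt_0_compat; lra|].
  intros z Hzw Hz. apply HP.
  set (d := fun k => (z ^ S k - w ^ S k) / RtoC (INR (S k) ^ n)).
  assert (Hd : is_series d (f z - f w)).
  { generalize (is_series_plus _ _ _ _ (Hf z Hz) (is_series_opp _ _ (Hf w Hw))).
    apply is_series_ext. intro k. unfold d.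
    change (z ^ S k / (INR (S k) ^ n)%R + - (w ^ S k / (INR (S k) ^ n)%R) = (z ^ S k - w ^ S k) / (INR (S k) ^ n)%R).
    unfold Cdiv. ring. }
  assert (HdC : forall k, (Cmod (d k) = Cmod (z ^ S k - w ^ S k) * / (INR (S k) ^ n))%R).
  { intro k. assert (H : 0 < INR (S k) ^ n) by (apply pow_lt, lt_0_INR; lia).
    unfold d, Cdiv. rewrite Cmod_mult, Cmod_inv by (apply RtoC_neq_0; lra).
    now rewrite Cmod_R, Rabs_pos_eq by lra. }
  assert (Hk1 : forall k, 1 <= INR (S k)) by (intro k; rewrite S_INR; generalize (pos_INR k); lra).
  assert (Hkn : forall k j : nat, (j <= n)%nat -> (/ (INR (S k) ^ n) <= / (INR (S k) ^ j))%R).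
  { intros k j Hj. apply Rinv_le_contravar; [apply pow_lt; specialize (Hk1 k); lra|].
    now apply Rle_pow. }
  assert (Hsmall : forall k, Cmod (d k) <= Cmod (z - w)).
  { intro k. rewrite HdC. assert (H := Cpow_lipschitz z w (S k) Hz Hw).
    assert (H1 := Hkn k 1%nat ltac:(lia)). rewrite pow_1 in H1. specialize (Hk1 k).
    apply Rle_trans with (INR (S k) * Cmod (z - w) * / INR (S k))%R.
    - apply Rmult_le_compat; try assumption; [apply Cmod_ge_0|].
      left. apply Rinv_0_lt_compat, pow_lt. lra.
    - right. field. lra. }
  assert (Htail : forall k, Cmod (d k) <= 4 * / ((INR k + 1) * (INR k + 1 + 1))).
  { intro k. rewrite HdC. assert (H1 := Hkn k 2%nat Hn). rewrite S_INR in *.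
    assert (Hk := pos_INR k).
    apply Rle_trans with (2 * / (INR k + 1) ^ 2)%R.
    - apply Rmult_le_compat; try assumption; [apply Cmod_ge_0 | |].
      + left. apply Rinv_0_lt_compat, pow_lt. lra.
      + eapply Rle_trans; [apply Cmod_triangle|]. rewrite Cmod_opp.
        generalize (Cmod_pow_le_1 z (S k) Hz) (Cmod_pow_le_1 w (S k) Hw). lra.
    - apply (Rmult_le_reg_r ((INR k + 1) ^ 2 * (INR k + 1 + 1))%R).
      { apply Rmult_lt_0_compat; [apply pow_lt|]; lra. }
      replace (2 * / (INR k + 1) ^ 2 * ((INR k + 1) ^ 2 * (INR k + 1 + 1)))%R
        with (2 * (INR k + 1 + 1))%R by (field; lra).
      replace (4 * / ((INR k + 1) * (INR k + 1 + 1)) * ((INR k + 1) ^ 2 * (INR k + 1 + 1)))%R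
        with (4 * (INR k + 1))%R by (field; lra). lra. }
  assert (Hsum : Cmod (sum_n d N) <= (INR N + 1) * Cmod (z - w)).
  { eapply Rle_trans; [apply (norm_sum_n_m (V := C_NormedModule) d)|].
    eapply Rle_trans; [apply (sum_n_m_le _ (fun _ => Cmod (z - w))); exact Hsmall|].
    rewrite sum_n_m_const, Nat.sub_0_r, S_INR. lra. }
  assert (Hrest : Cmod (f z - f w - sum_n d N) <= 4 * / (INR N + 2)).
  { assert (Hr : is_series (fun k => d (S N + k)%nat) (f z - f w - sum_n d N)).
    { apply is_series_incr_n; [lia|]. simpl pred.
      match goal with |- is_series _ ?s => replace s with (f z - f w) end; [exact Hd|].
      change (f z - f w = f z - f w - sum_n d N + sum_n d N). Cring. }
    set (b := fun k => (/ ((INR N + 2 + INR k) * (INR N + 2 + INR k + 1)))%R).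
    assert (Ht : is_series b (/ (INR N + 2))%R) by (apply is_series_telescope; lra).
    rewrite <- (is_series_unique _ _ Ht), <- Series_scal_l.
    apply (is_series_Cmod_le _ _ _ Hr); [|exact (ex_series_scal_l _ _ (ex_intro _ _ Ht))].
    intro k. eapply Rle_trans; [apply Htail|]. right. unfold b.
    rewrite plus_INR, S_INR. do 2 f_equal. f_equal; ring. }
  replace (f z - f w) with (f z - f w - sum_n d N + sum_n d N) by ring.
  eapply Rle_lt_trans; [apply Cmod_triangle|].
  apply Rlt_le_trans with (eps / 2 + eps / 2)%R; [|lra].
  apply Rplus_le_lt_compat.
  - eapply Rle_trans; [exact Hrest|]. apply (Rmult_le_reg_r (INR N + 2)); [lra|].
    replace (4 * / (INR N + 2) * (INR N + 2))%R with (eps * (8 / eps) / 2)%R by (field; lra).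
    assert (H := Rmult_lt_compat_l eps _ _ Heps HN). lra.
  - eapply Rle_lt_trans; [exact Hsum|].
    apply (Rmult_lt_compat_l (INR N + 1)) in Hzw; [|lra].
    replace ((INR N + 1) * (eps / (2 * (INR N + 1))))%R with (eps / 2)%R in Hzw by (field; lra).
    exact Hzw.
Qed.

Lemma filterlim_vertical (a : R) :
  filterlim (fun e : R => (a, e) : C) (at_right 0) (locally (RtoC a)).
Proof.
  intros Q HQ. apply locally_Cmod in HQ. destruct HQ as [d [Hd HQ]].
  exists (mkposreal d Hd).
  refine (fun (e : R) (He : Rabs (e - 0) < d) _ => _). rewrite Rminus_0_r in He.
  apply HQ. replace ((a, e) - RtoC a) with (RtoC e * Ci) by (apply injective_projections; cbn; ring).
  rewrite Cmod_mult, Cmod_R, Cmod_Ci. lra.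
Qed.

(** A positive real point [y] lies in the slit plane, at its tip, or on the cut; the limit comes from
    analyticity, from the continuity on the closed disk, and from the hypothesis on the cut,
    respectively. *)
Lemma polylog_boundary (n : nat) (f : C -> C) (y : R) (gam : R -> C) (side : C -> Prop) :
  (2 <= n)%nat -> is_polylog n f ->
  filterlim gam (at_right 0) (locally (RtoC y)) ->
  (y = 1%R -> forall e, Cmod (gam e) <= 1) ->
  at_right 0 (fun e => side (gam e)) ->
  (on_cut y -> filterlim f (within side (locally (RtoC y))) (locally (f y))) ->
  filterlim (fun e => f (gam e)) (at_right 0) (locally (f y)).
Proof.
  intros Hn Hf Hg H1 Hside Hcut.
  assert (Hw : forall D : C -> Prop, at_right 0 (fun e => D (gam e)) ->
    filterlim gam (at_right 0) (within D (locally (RtoC y)))).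
  { intros D HD Q HQ. specialize (Hg _ HQ). unfold filtermap in *.
    generalize (filter_and (F := at_right 0) _ _ HD Hg). apply filter_imp. intros e [He1 He2]. now apply He2. }
  destruct (Rtotal_order y 1) as [Hlt|[Heq|Hgt]].
  - assert (Ha : analytic_at f y).
    { apply Hf. intros [H _]. cbn in H. lra. }
    apply analytic_at_C_derive in Ha. destruct Ha as [_ Ha].
    exact (filterlim_comp _ _ _ gam f _ _ _ Hg (is_cderive_continuous _ _ _ Ha)).
  - refine (filterlim_comp _ _ _ gam f _ _ _ (Hw (fun z => Cmod z <= 1) _) _).
    + apply filter_forall. now apply H1.
    + apply (is_polylog_continuous_disk n); trivial.
      rewrite Heq, Cmod_R, Rabs_R1. lra.
  - refine (filterlim_comp _ _ _ gam f _ _ _ (Hw side Hside) _).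
    apply Hcut. split; cbn; [lra | reflexivity].
Qed.

Lemma small_angle : at_right 0 (fun e => 0 < e < PI).
Proof.
  exists (mkposreal PI PI_RGT_0). intros e He He0.
  change (Rabs (e - 0) < PI) in He. rewrite Rminus_0_r, Rabs_pos_eq in He; lra.
Qed.

(** * The inversion formula *)

(** The exponential maps this strip onto the plane without [[0, +oo)], which is stable under inversion
    and contained in the slit plane. It contains [i_pi], the logarithm of the fixed point -1. *)
Definition strip (w : C) : Prop := 0 < Im w < 2 * PI.

Lemma strip_slit (w : C) : strip w -> slit (Cexp w) /\ slit (Cexp (- w)).
Proof.
  assert (Hcos : forall b : R, 0 < b < 2 * PI -> sin b = 0%R -> cos b = (-1)%R).
  { intros b Hb Hs. assert (Hpi := PI_RGT_0).
    destruct (Rtotal_order b PI) as [H|[->|H]].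
    - assert (0 < sin b) by (apply sin_gt_0; lra). lra.
    - apply cos_PI.
    - assert (sin b < 0) by (apply sin_lt_0; lra). lra. }
  destruct w as [a b]. unfold strip, slit. cbn. intro Hb.
  split; intros [H1 H2].
  - assert (Ha := exp_pos a).
    assert (Hs : sin b = 0%R) by (apply (Rmult_eq_reg_l (exp a)); lra).
    rewrite (Hcos b Hb Hs) in H1. lra.
  - assert (Ha := exp_pos (- a)). rewrite sin_neg in H2. rewrite cos_neg in H1.
    assert (Hs : sin b = 0%R) by (apply (Rmult_eq_reg_l (exp (- a))); lra).
    rewrite (Hcos b Hb Hs) in H1. lra.
Qed.

Lemma strip_constant (f : C -> C) (a b : C) :
  (forall w, strip w -> is_cderive f w 0) -> strip a -> strip b -> f b = f a.
Proof.
  intros Hf Ha Hb. apply zero_cderive_segment. intros t Ht. apply Hf.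
  destruct a as [a1 a2], b as [b1 b2]. unfold strip in *. cbn in *. 
  assert (0 < (1 - t) * a2 + t * b2 < 2 * PI); [|lra].
  destruct (Rle_lt_or_eq_dec 0 t ltac:(lra)) as [H|<-]; [|lra].
  split; nra.
Qed.

Definition two_pi_i : C := 2 * PI * Ci.

Lemma two_pi_i_neq_0 : two_pi_i <> 0.
Proof.
  assert (H := PI_RGT_0). unfold two_pi_i.
  repeat apply Cmult_neq_0; try (apply RtoC_neq_0; lra).
  intro E. apply (f_equal snd) in E. cbn in E. lra.
Qed.

(** The two cases of the inversion formula read Li_n(x) + (-1)^n Li_n(1/x) = - (2 pi i)^n B_n(u) / n!
    with u = log x / (2 pi i); this is the difference of the two sides in the variable w = log x. *)
Definition inversion_defect (Li B : nat -> C -> C) (n : nat) (w : C) : C :=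
  polylog_ext Li n (Cexp w) + (- (1)) ^ n * polylog_ext Li n (Cexp (- w))
    + two_pi_i ^ n * scaled_bernoulli B n (w / two_pi_i).

Definition i_pi : C := (0%R, PI).

Lemma strip_i_pi : strip i_pi.
Proof. unfold strip. cbn. generalize PI_RGT_0. lra. Qed.

Section Inversion.

Context (Li B : nat -> C -> C) (hB : is_bernoulli B)
  (hLi : forall n : nat, (2 <= n)%nat -> is_polylog n (Li n)).

Local Notation P := (inversion_defect Li B).

Lemma inversion_defect_derive (n : nat) (w : C) :
  strip w -> is_cderive (P (S n)) w (P n w).
Proof.
  intro Hw. destruct (strip_slit w Hw) as [S1 S2].
  destruct (polylog_ext_derive Li hLi n _ S1) as [l1 [D1 E1]].
  destruct (polylog_ext_derive Li hLi n _ S2) as [l2 [D2 E2]].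
  assert (Hm : is_cderive (fun w => - w) w (- (1))).
  { generalize (is_cderive_linear (- (1)) w). apply is_cderive_ext. intro u. ring. }
  assert (H1 := is_cderive_comp _ _ _ _ _ D1 (is_cderive_Cexp w)).
  assert (H2 := is_cderive_comp (polylog_ext Li (S n)) (fun w => Cexp (- w)) _ _ _ D2
    (is_cderive_comp Cexp _ _ _ _ (is_cderive_Cexp (- w)) Hm)).
  assert (H3 : is_cderive (fun w => scaled_bernoulli B (S n) (w / two_pi_i)) w
    (/ two_pi_i * scaled_bernoulli B n (w / two_pi_i))).
  { apply (is_cderive_comp (scaled_bernoulli B (S n)) (fun w => w / two_pi_i)).
    - now apply scaled_bernoulli_derive.
    - generalize (is_cderive_linear (/ two_pi_i) w). apply is_cderive_ext. intro u.
      unfold Cdiv. apply Cmult_comm. }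
  assert (H4 := is_cderive_plus _ _ _ _ _
    (is_cderive_plus _ _ _ _ _ H1
       (is_cderive_mult _ _ _ _ _ (is_cderive_const ((- (1)) ^ S n) w) H2))
    (is_cderive_mult _ _ _ _ _ (is_cderive_const (two_pi_i ^ S n) w) H3)).
  unfold inversion_defect at 2.
  match type of H4 with is_cderive _ _ ?l => match goal with |- is_cderive _ _ ?m => replace m with l end end.
  { exact H4. }
  rewrite <- E1, <- E2, !Cpow_S. field. exact two_pi_i_neq_0.
Qed.

(** x / (1 - x) + x^-1 / (1 - x^-1) = -1. *)
Lemma inversion_defect_0 (w : C) : strip w -> P 0 w = 0.
Proof.
  intro Hw. destruct (strip_slit w Hw) as [S1 S2].
  apply slit_1 in S1. apply slit_1 in S2. unfold inversion_defect.
  rewrite (scaled_bernoulli_0 B hB). simpl polylog_ext. rewrite Cexp_opp in *.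
  assert (H := Cexp_neq_0 w). simpl Cpow. field. repeat split; trivial.
  intro E. apply S1. replace (1 - Cexp w) with (- (Cexp w - 1)) by ring. rewrite E. ring.
Qed.

(** At x = -1 the two polylogarithms cancel for odd order, and u = 1/2. *)
Lemma inversion_defect_odd_i_pi (m : nat) : P (2 * m + 1) i_pi = 0.
Proof.
  unfold inversion_defect.
  assert (E1 : Cexp i_pi = - (1)).
  { unfold Cexp, i_pi. cbn. rewrite exp_0, cos_PI, sin_PI. apply injective_projections; cbn; ring. }
  rewrite Cexp_opp, E1.
  replace (/ - (1)) with (- (1)) by (field; intro E; apply (f_equal fst) in E; cbn in E; lra).
  replace (i_pi / two_pi_i) with (/ 2).
  2:{ replace i_pi with (/ 2 * two_pi_i).
      - field. exact two_pi_i_neq_0.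
      - unfold i_pi, two_pi_i. apply injective_projections; cbn; field. }
  rewrite (scaled_bernoulli_odd_half B hB), Cpow_add_r, Cpow_opp_1_even. simpl. ring.
Qed.

(** Above a positive real point [r] the argument e^w tends to [r] from the upper half-plane and e^(-w)
    to 1/r from the lower one. *)
Lemma inversion_defect_boundary (n : nat) (r : R) :
  (2 <= n)%nat -> 0 < r ->
  (on_cut r -> limit_from_above (Li n) r) ->
  (on_cut (/ r) -> limit_from_below (Li n) (/ r)) ->
  filterlim (fun e : R => P n (ln r, e)) (at_right 0)
    (locally (Li n r + (- (1)) ^ n * Li n (/ r) + two_pi_i ^ n * scaled_bernoulli B n (ln r / two_pi_i))).
Proof.
  intros Hn Hr Habove Hbelow.
  destruct n as [|[|n]]; [lia | lia |].
  rewrite <- RtoC_inv in * by lra.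
  assert (Hv := filterlim_vertical (ln r)).
  assert (H1 : filterlim (fun e : R => Li (S (S n)) (Cexp (ln r, e))) (at_right 0) (locally (Li (S (S n)) r))).
  { apply (polylog_boundary (S (S n)) _ r _ (fun z => 0 < Im z)); auto.
    - assert (H := is_cderive_continuous _ _ _ (is_cderive_Cexp (ln r))).
      rewrite RtoC_exp, exp_ln in H by trivial.
      exact (filterlim_comp _ _ _ _ Cexp _ _ _ Hv H).
    - intros E e. rewrite Cmod_Cexp, exp_ln by trivial. lra.
    - generalize small_angle. apply filter_imp. intros e He. cbn.
      apply Rmult_lt_0_compat; [apply exp_pos | apply sin_gt_0; lra]. }
  assert (Hopp : forall z : C, is_cderive (fun w => Cexp (- w)) z (- (1) * Cexp (- z))).
  { intro z. apply (is_cderive_comp Cexp (fun w => - w)); [apply is_cderive_Cexp|].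
    generalize (is_cderive_linear (- (1)) z). apply is_cderive_ext. intro u. ring. }
  assert (H2 : filterlim (fun e : R => Li (S (S n)) (Cexp (- (ln r, e)))) (at_right 0) (locally (Li (S (S n)) (/ r)%R))).
  { apply (polylog_boundary (S (S n)) _ (/ r) _ (fun z => Im z < 0)); auto.
    - assert (H := is_cderive_continuous _ _ _ (Hopp (ln r))).
      cbv beta in H. rewrite Cexp_opp, RtoC_exp, exp_ln, <- RtoC_inv in H by lra.
      exact (filterlim_comp _ _ _ _ _ _ _ _ Hv H).
    - intros E e. change (- (ln r, e)) with ((- ln r)%R, (- e)%R).
      rewrite Cmod_Cexp, exp_Ropp, exp_ln by trivial. lra.
    - generalize small_angle. apply filter_imp. intros e He. cbn. rewrite sin_neg.
      assert (Hs : 0 < sin e) by (apply sin_gt_0; lra). assert (Hx := exp_pos (- ln r)). nra. }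
  assert (H3 : filterlim (fun e : R => scaled_bernoulli B (S (S n)) ((ln r, e) / two_pi_i)) (at_right 0)
    (locally (scaled_bernoulli B (S (S n)) (ln r / two_pi_i)))).
  { assert (H := is_cderive_comp (scaled_bernoulli B (S (S n))) _ (ln r) _ _
      (scaled_bernoulli_derive B hB (S n) _) (is_cderive_linear (/ two_pi_i) (ln r))).
    apply is_cderive_continuous in H. cbv beta in H. rewrite Cmult_comm in H.
    apply (filterlim_ext (fun e : R => scaled_bernoulli B (S (S n)) (/ two_pi_i * (ln r, e)))).
    { intro e. f_equal. unfold Cdiv. apply Cmult_comm. }
    exact (filterlim_comp _ _ _ _ _ _ _ _ Hv H). }
  unfold inversion_defect, polylog_ext.
  assert (Hplus : forall (f g : R -> C) (u v : C), filterlim f (at_right 0) (locally u) ->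
    filterlim g (at_right 0) (locally v) -> filterlim (fun e => f e + g e) (at_right 0) (locally (u + v))).
  { intros f g u v Hf Hg. eapply filterlim_comp_2; [exact Hf | exact Hg | apply (@filterlim_plus C_AbsRing C_NormedModule)]. }
  assert (Hc : forall (c : C) (f : R -> C) (v : C), filterlim f (at_right 0) (locally v) ->
    filterlim (fun e => c * f e) (at_right 0) (locally (c * v))).
  { intros c f v Hf. apply filterlim_Cmult; trivial; [apply at_right_proper_filter | apply filterlim_const]. }
  auto.
Qed.

Lemma boundary_value (n : nat) (r : R) (l : C) :
  (forall w, strip w -> P n w = 0) ->
  filterlim (fun e : R => P n (ln r, e)) (at_right 0) (locally l) -> l = 0.
Proof.
  intros HP Hl.
  apply (@filterlim_locally_unique R C_AbsRing C_NormedModule (at_right 0)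
    (Proper_StrongProper _ (at_right_proper_filter 0)) (fun e : R => P n (ln r, e))); trivial.
  apply (filterlim_ext_loc (fun _ => RtoC 0)); [|apply filterlim_const].
  generalize small_angle. apply filter_imp. intros e He. symmetry. apply HP. unfold strip. cbn. lra.
Qed.

(** For x = 1: the two values Li_n(1) cancel for odd order, and B_n(0) = 0. *)
Lemma inversion_defect_odd_origin (m : nat) :
  filterlim (fun e : R => P (2 * m + 3) (0%R, e)) (at_right 0) (locally (RtoC 0)).
Proof.
  assert (H := inversion_defect_boundary (2 * m + 3) 1 ltac:(lia) Rlt_0_1).
  rewrite ln_1 in H.
  assert (H1 : ~ on_cut 1) by (intros [H1 _]; cbn in H1; lra).
  assert (H2 : / 1 = 1) by (field; exact C1_nz).
  rewrite H2 in H. specialize (H (fun h => False_ind _ (H1 h)) (fun h => False_ind _ (H1 h))).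
  match type of H with filterlim _ _ (locally ?l) => replace (RtoC 0) with l end; [exact H|].
  replace (0 / two_pi_i) with (RtoC 0) by (unfold Cdiv; ring).
  rewrite (scaled_bernoulli_odd_0 B hB), Cpow_add_r, Cpow_opp_1_even. simpl Cpow. ring.
Qed.

Lemma inversion_defect_const (n : nat) :
  (forall w, strip w -> P n w = 0) -> forall w, strip w -> P (S n) w = P (S n) i_pi.
Proof.
  intros HP w Hw. apply (strip_constant (P (S n)) i_pi w); trivial using strip_i_pi.
  intros u Hu. rewrite <- (HP u Hu). now apply inversion_defect_derive.
Qed.

(** Two integration constants are removed at a time. If the defect of order 2m+1 vanishes, the one of
    order 2m+2 is a constant c, and the one of order 2m+3 is linear in w with slope c. The latter
    vanishes at i pi and tends to 0 at the origin, so c = 0 and both are zero. *)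
Lemma inversion_defect_vanishes_pair (m : nat) :
  (forall w, strip w -> P (2 * m) w = 0) /\ (forall w, strip w -> P (2 * m + 1) w = 0).
Proof.
  assert (Hodd : forall k, (forall w, strip w -> P (2 * k) w = 0) -> forall w, strip w -> P (2 * k + 1) w = 0).
  { intros k Hk w Hw. rewrite <- (inversion_defect_odd_i_pi k).
    replace (2 * k + 1)%nat with (S (2 * k)) by lia. now apply inversion_defect_const. }
  induction m as [|m [_ IH]].
  { assert (H0 : forall w, strip w -> P (2 * 0) w = 0) by (intros w Hw; now apply inversion_defect_0).
    split; [exact H0 | now apply Hodd]. }
  set (c := P (2 * m + 2) i_pi).
  assert (Hc : forall w, strip w -> P (2 * m + 2) w = c).
  { unfold c. replace (2 * m + 2)%nat with (S (2 * m + 1)) by lia. now apply inversion_defect_const. }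
  assert (Hlin : forall w, strip w -> P (2 * m + 3) w = c * (w - i_pi)).
  { intros w Hw.
    assert (H : P (2 * m + 3) w + - c * w = P (2 * m + 3) i_pi + - c * i_pi).
    { apply (strip_constant (fun w => P (2 * m + 3) w + - c * w)); trivial using strip_i_pi.
      intros u Hu. replace (RtoC 0) with (P (2 * m + 2) u + - c) by (rewrite Hc by trivial; ring).
      apply is_cderive_plus; [|apply is_cderive_linear].
      replace (2 * m + 3)%nat with (S (2 * m + 2)) by lia. now apply inversion_defect_derive. }
    assert (H0 := inversion_defect_odd_i_pi (S m)).
    replace (2 * S m + 1)%nat with (2 * m + 3)%nat in H0 by lia. rewrite H0 in H.
    replace (P (2 * m + 3) w) with (P (2 * m + 3) w + - c * w + c * w) by ring. rewrite H. ring. }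
  (* At the origin the linear function c (w - i pi) must vanish too. *)
  assert (Hc0 : c = 0).
  { assert (Hlim : c * (0 - i_pi) = 0).
    { apply (@filterlim_locally_unique R C_AbsRing C_NormedModule (at_right 0)
        (Proper_StrongProper _ (at_right_proper_filter 0)) (fun e : R => P (2 * m + 3) (0%R, e)));
        [|apply inversion_defect_odd_origin].
      apply (filterlim_ext_loc (fun e : R => c * ((0%R, e) - i_pi))).
      - generalize small_angle. apply filter_imp. intros e He. symmetry. apply Hlin. unfold strip. cbn. lra.
      - assert (D := is_cderive_plus _ _ _ _ _ (is_cderive_linear c 0) (is_cderive_const (- (c * i_pi)) 0)).
        apply is_cderive_continuous in D. cbv beta in D.
        replace (c * (0 - i_pi)) with (c * 0 + - (c * i_pi)) by ring.
        apply (filterlim_ext (fun e : R => c * (0%R, e) + - (c * i_pi))); [intro e; ring|].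
        exact (filterlim_comp _ _ _ _ _ _ _ _ (filterlim_vertical 0) D). }
    destruct (Ceq_dec c 0) as [|Hn]; trivial. exfalso. revert Hlim. apply Cmult_neq_0; trivial.
    intro E. apply (f_equal snd) in E. cbn in E. generalize PI_RGT_0. lra. }
  assert (Heven : forall w, strip w -> P (2 * S m) w = 0).
  { intros w Hw. replace (2 * S m)%nat with (2 * m + 2)%nat by lia. rewrite Hc; trivial. }
  split; [exact Heven | now apply Hodd].
Qed.

Lemma inversion_defect_vanishes (n : nat) (w : C) : strip w -> P n w = 0.
Proof.
  destruct (Nat.Even_or_Odd n) as [[m ->]|[m ->]]; apply inversion_defect_vanishes_pair.
Qed.

(** If log x lies in the strip the defect vanishes at log x; otherwise x is a positive real number
    and the formula is the boundary value of the defect. *)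
Theorem polylog_inversion (n : nat) (x : C) :
  (2 <= n)%nat -> x <> 0 -> 0 <= Im x ->
  (on_cut x -> limit_from_above (Li n) x) ->
  (on_cut (/ x) -> limit_from_below (Li n) (/ x)) ->
  Li n x + (- (1)) ^ n * Li n (/ x) + two_pi_i ^ n * scaled_bernoulli B n (Clog x / two_pi_i) = 0.
Proof.
  intros Hn Hx0 Hx Habove Hbelow. assert (Hpi := PI_RGT_0).
  assert (Hexp := Cexp_Clog x Hx0 Hx). assert (Hm := proj1 (Cmod_gt_0 x) Hx0).
  destruct (acos_bound (Re x / Cmod x)) as [[Hpos|Hzero] Hle].
  - assert (Hs : strip (Clog x)).
    { unfold strip, Clog, Carg. cbn [Im snd]. destruct (Rle_dec 0 (Im x)); [lra | contradiction]. }
    assert (H := inversion_defect_vanishes n _ Hs). unfold inversion_defect in H.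
    rewrite Cexp_opp, Hexp in H.
    destruct n as [|[|n]]; [lia | lia | exact H].
  - assert (Ew : Clog x = RtoC (ln (Cmod x))).
    { unfold Clog, Carg. destruct (Rle_dec 0 (Im x)); [now rewrite <- Hzero | contradiction]. }
    assert (Ex : x = RtoC (Cmod x)).
    { rewrite <- Hexp at 1. rewrite Ew, RtoC_exp, exp_ln; trivial. }
    rewrite Ew. set (r := Cmod x) in *. clearbody r. subst x.
    apply (boundary_value n r).
    + intros w Hw. now apply inversion_defect_vanishes.
    + now apply inversion_defect_boundary.
Qed.

End Inversion.

Theorem proposition3 (B : nat -> C -> C) (hB : is_bernoulli B)
  (Li : nat -> C -> C) (hLi : forall n : nat, (2 <= n)%nat -> is_polylog n (Li n))
  (x : C) (hx0 : x <> 0) (hx : 0 <= Im x)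
  (hcut : on_cut x -> forall n : nat, (2 <= n)%nat -> limit_from_above (Li n) x)
  (hcutV : on_cut (/ x) -> forall n : nat, (2 <= n)%nat -> limit_from_below (Li n) (/ x))
  (p : nat) (hp : (1 <= p)%nat) :
  Li (2 * p)%nat x + Li (2 * p)%nat (/ x)
    = (- 1) ^ (p + 1) * (2 * PI) ^ (2 * p) / RtoC (INR (fact (2 * p)))
      * B (2 * p)%nat (Clog x / (2 * PI * Ci))
  /\
  Li (2 * p + 1)%nat x - Li (2 * p + 1)%nat (/ x)
    = (- 1) ^ (p + 1) * (2 * PI) ^ (2 * p + 1) * Ci / RtoC (INR (fact (2 * p + 1)))
      * B (2 * p + 1)%nat (Clog x / (2 * PI * Ci)).
Proof.
  assert (E1 : RtoC (- 1) = - (1)) by (apply injective_projections; cbn; ring).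
  rewrite E1.
  assert (Hi : two_pi_i ^ (2 * p) = (- (1)) ^ p * (2 * PI) ^ (2 * p)).
  { unfold two_pi_i. rewrite Cpow_mult_l, (Cpow_mult_r Ci).
    replace (Ci ^ 2) with (- (1)) by (simpl; apply injective_projections; cbn; ring). apply Cmult_comm. }
  (* Both parts are [polylog_inversion], with the powers of -1 and of i separated. *)
  split.
  - assert (H := polylog_inversion Li B hB hLi (2 * p) x ltac:(lia) hx0 hx
      (fun h => hcut h (2 * p)%nat ltac:(lia)) (fun h => hcutV h (2 * p)%nat ltac:(lia))).
    rewrite Cpow_opp_1_even, Hi in H. unfold scaled_bernoulli in H. fold two_pi_i.
    rewrite Cpow_add_r.
    set (b := B _ _) in *. set (l := Li _ x) in *. set (l' := Li _ (/ x)) in *.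
    match type of H with ?u = _ => replace (l + l') with (l + l' - u) by (rewrite H; ring) end.
    unfold Cdiv. rewrite !Cpow_1_r. ring.
  - assert (H := polylog_inversion Li B hB hLi (2 * p + 1) x ltac:(lia) hx0 hx
      (fun h => hcut h (2 * p + 1)%nat ltac:(lia)) (fun h => hcutV h (2 * p + 1)%nat ltac:(lia))).
    rewrite !Cpow_add_r, Cpow_opp_1_even, Hi in H. unfold scaled_bernoulli in H. fold two_pi_i.
    rewrite !Cpow_add_r.
    set (b := B _ _) in *. set (l := Li _ x) in *. set (l' := Li _ (/ x)) in *.
    match type of H with ?u = _ => replace (l - l') with (l - l' - u) by (rewrite H; ring) end.
    unfold two_pi_i, Cdiv. rewrite !Cpow_1_r. ring.
Qed.
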